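(* Let $\mathbb{F}$ be an infinite field of arbitrary characteristic, and let $n=3$, $d=2$. Then the following set is a minimal (with respect to inclusion) separating set for the algebra $R^{GL(3)}$ of $GL(3)$-invariants of two $3\times 3$ matrices: $$\operatorname{tr}(X_i),\ \sigma_2(X_i),\ \det(X_i)\quad (i=1,2),$$ $$\operatorname{tr}(X_1X_2),\ \operatorname{tr}(X_1^2X_2),\ \operatorname{tr}(X_1X_2^2),\ \operatorname{tr}(X_1^2X_2^2),\ \operatorname{tr}(X_1^2X_2^2X_1X_2).$$
   Context: Let $R=\mathbb{F}[x_{ij}(k)\mid 1\le i,j\le n,\ 1\le k\le d]$ and let $X_k$ ($1\le k\le d$) be the $n\times n$ generic matrix with $(i,j)$ entry $x_{ij}(k)$. For an $n\times n$ matrix $A$ over a commutative ring, $\sigma_t(A)$ denotes the $t$-th coefficient of the characteristic polynomial, normalized by $\det(\lambda I-A)=\sum_{t=0}^n(-1)^t\sigma_t(A)\lambda^{n-t}$; so $\sigma_1=\operatorname{tr}$, $\sigma_n=\det$. Let $M(n)$ be the space of $n\times n$ matrices over $\mathbb{F}$ and $H=M(n)^{\oplus d}$, on which $GL(n)=GL_n(\mathbb{F})$ acts by $g\cdot(A_1,\ldots,A_d)=(gA_1g^{-1},\ldots,gA_dg^{-1})$. Elements of $R$ are regarded as polynomial functions $H\to\mathbb{F}$, where $x_{ij}(k)$ sends $(A_1,\ldots,A_d)$ to the $(i,j)$ entry of $A_k$. The algebra $R^{GL(n)}=\{f\in R\mid f(g\cdot v)=f(v)\ \text{for all } g\in GL(n),\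 v\in H\}$ is (by a known theorem) the $\mathbb{F}$-subalgebra of $R$ generated by all $\sigma_t(b)$, where $1\le t\le n$ and $b$ ranges over all monomials in $X_1,\ldots,X_d$. A subset $S\subset R^{GL(n)}$ separates $u,v\in H$ if there is $f\in S$ with $f(u)\ne f(v)$. The set $S$ is called separating if any $u,v\in H$ that are separated by $R^{GL(n)}$ are separated by $S$. A separating set is minimal if no proper subset of it is separating. *)

(* Defs.v *)
From HB Require Import structures.
From mathcomp Require Import all_boot all_order all_algebra.
From mathcomp Require Import mpoly.
From mathcomp Require Import classical_sets cardinality.

Set Implicit Arguments.
Unset Strict Implicit.
Unset Printing Implicit Defensive.

Import GRing.Theory.
Local Open Scope classical_set_scope.
Local Open Scope ring_scope.

(* The type of triples (k, i, j) indexing the variables x_ij(k); since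
   {mpoly F[N]} has its variables indexed by 'I_N, a triple is identified with
   its rank in the enumeration of this finite type. *)
Definition var_index (n d : nat) : finType := ('I_d * 'I_n * 'I_n)%type.

Definition matpoly (F : fieldType) (n d : nat) :=
  {mpoly F[#|var_index n d|]}.

Definition generic_mx (F : fieldType) (n d : nat) (k : 'I_d) :
    'M[matpoly F n d]_n :=
  \matrix_(i < n, j < n) 'X_(enum_rank ((k, i, j) : var_index n d)).

(* \det (lambda I - A) = \sum_(0 <= t <= n) (-1)^t sigma_t(A) lambda^(n-t);
   only meaningful for t <= n. *)
Definition sigma (R : comNzRingType) (n t : nat) (A : 'M[R]_n) : R :=
  (-1) ^+ t * (char_poly A)`_(n - t).

Definition mxtuple (F : fieldType) (n d : nat) := 'I_d -> 'M[F]_n.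

Definition conj_act (F : fieldType) (n d : nat) (g : 'M[F]_n)
    (v : mxtuple F n d) : mxtuple F n d :=
  fun k => g *m v k *m invmx g.

Definition mxeval (F : fieldType) (n d : nat) (f : matpoly F n d)
    (v : mxtuple F n d) : F :=
  f.@[fun a => let: (k, i, j) := (enum_val a : var_index n d) in v k i j].

Definition GL_invariants (F : fieldType) (n d : nat) : set (matpoly F n d) :=
  [set f | forall (g : 'M[F]_n) (v : mxtuple F n d),
     g \in unitmx -> mxeval f (conj_act g v) = mxeval f v].

Definition separates (F : fieldType) (n d : nat) (S : set (matpoly F n d))
    (u v : mxtuple F n d) : Prop :=
  exists2 f, S f & mxeval f u <> mxeval f v.

Definition separating (F : fieldType) (n d : nat)
    (S : set (matpoly F n d)) : Prop :=
  S `<=` @GL_invariants F n d /\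
  forall u v : mxtuple F n d,
    separates (@GL_invariants F n d) u v -> separates S u v.

Definition minimal_separating (F : fieldType) (n d : nat)
    (S : set (matpoly F n d)) : Prop :=
  separating S /\ forall S' : set (matpoly F n d), S' `<` S -> ~ separating S'.

(* Main.v *)
(* Two pairs [u, v] of 3 x 3 matrices on which the 11 functions agree have the
   same traces on all words, by a reduction based on the polarised
   Cayley-Hamilton identity for [X Y X]; hence [\tr], [sigma 2] and [\det] agree
   on the algebra [E] generated by the pairs [(u k, v k)]. Invariance of [f]
   persists over extension fields of the infinite field [F], so eigenvalues may
   be adjoined freely. If some [(P, P')] in [E] has three distinct eigenvalues,
   conjugate [P] and [P'] to the same diagonal matrix: by torus invariance, [f]
   only involves monomials that are products of cycles of length at most 3, and
   these are traces of elements of [E]. Otherwise every element of the algebra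
   of [u] has a repeated eigenvalue; then [u] is triangularizable, [f u] is the
   value of [f] at the diagonal part, which has the shape
   [(diag (a, x, x), diag (b, y, y))] and is determined by the characteristic
   polynomials of [u]; likewise for [v]. *)
Require Import Defs.
From HB Require Import structures.
From mathcomp Require Import all_boot all_order all_algebra.
From mathcomp Require Import fieldext.
From mathcomp Require Import perm.
From mathcomp Require Import mpoly.
From mathcomp Require Import boolp classical_sets cardinality.
From mathcomp Require Import ring zify.

Set Implicit Arguments.
Unset Strict Implicit.
Unset Printing Implicit Defensive.

Import GRing.Theory.
Local Open Scope classical_set_scope.
Local Open Scope ring_scope.

(** * Extension of scalars *)

(** Arbitrary characteristic shapes the argument. Traces alone do not determine [s2] and [\det] in
    characteristic 2 or 3, so all three coefficients are carried through the generation of [E], by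
    means of [s2 (X *m Y) = \tr (\adj Y *m \adj X)] and of the expansions of [s2] and [\det] on
    sums. Working with pairs lets one polynomial act on [P] and [P'] at once: Lagrange interpolation
    at three distinct eigenvalues puts every [delta_mx i i], paired with itself, into [E], and
    inserting these between generators turns the product of the entries along a cycle into a trace.
    Without separable elements there is no such triple of idempotents, but triangularity suffices,
    since a one-parameter torus contracts a triangular tuple to its diagonal. Common eigenvectors
    come from a dichotomy: the algebra contains a rank one idempotent, or all its singular elements
    are nilpotent. Minimality rests on matrices with entries [0], [1], [-1], valid over every field:
    for each of the 11 functions, two tuples on which it alone differs. *)

Definition unbounded (F : eqType) := forall s : seq F, exists x, x \notin s.

Lemma infinite_unbounded (F : choiceType) :
  infinite_set [set: F] -> unbounded F.
Proof.
move=> infF s; apply: contra_notP infF => nx.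
apply/finite_seqP; exists s; apply/seteqP; split=> x //= _.
by apply: contra_notT nx => xs; exists x.
Qed.

Lemma unbounded_uniq (F : eqType) (n : nat) :
  unbounded F -> exists2 s : seq F, uniq s & size s = n.
Proof.
move=> infF; elim: n => [|n [s us sz]]; first by exists [::].
by have [x xs] := infF s; exists (x :: s); rewrite /= ?xs ?sz.
Qed.

Lemma unbounded_inj (F K : eqType) (h : F -> K) :
  injective h -> unbounded F -> unbounded K.
Proof.
move=> h_inj infF s; have [r ur szr] := unbounded_uniq (size s).+1 infF.
apply: contrapT => nx; have sub : {subset map h r <= s}.
  by move=> x _; apply: contra_notT nx => xs; exists x.
have ur' : uniq (map h r) by rewrite map_inj_uniq.
by have := uniq_leq_size ur' sub; rewrite size_map szr ltnn.
Qed.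

Lemma poly_eq0_unbounded (F K : fieldType) (h : {rmorphism F -> K})
    (p : {poly K}) :
  unbounded F -> (forall x, p.[h x] = 0) -> p = 0.
Proof.
move=> infF p0; apply/eqP/negPn/negP => pn0.
have [s us szs] := unbounded_uniq (size p) infF.
have rs : all (root p) (map h s).
  by apply/allP => _ /mapP[x _ ->]; apply/rootP.
have := max_poly_roots pn0 rs.
by rewrite (map_inj_uniq (fmorph_inj h)) size_map szs ltnn => /(_ us).
Qed.

Lemma poly_eq0_nz (K : fieldType) (p : {poly K}) :
  unbounded K -> (forall x, x != 0 -> p.[x] = 0) -> p = 0.
Proof.
move=> infK p0; suff /eqP: p * 'X = 0.
  by rewrite mulf_eq0 polyX_eq0 orbF => /eqP.
apply: (@poly_eq0_unbounded K K idfun) => // x /=; rewrite hornerMX.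
by have [->|/p0->] := eqVneq x 0; rewrite ?mulr0 ?mul0r.
Qed.

(** Coordinates in the image of [F] are replaced by arbitrary elements of [K] one at a time; at each
    replacement a one-variable polynomial vanishes because it has all the [h a] as roots. Since only
    polynomiality in each single coordinate is asked, [Phi] can be any expression in matrix
    entries. *)
Lemma separately_polynomial_eq0 (F K : fieldType) (h : {rmorphism F -> K})
    (T : finType) (Phi : (T -> K) -> K) :
    unbounded F ->
    (forall x t0, exists q : {poly K}, forall y,
        Phi (fun t => if t == t0 then y else x t) = q.[y]) ->
    (forall x : T -> F, Phi (h \o x) = 0) ->
  forall x, Phi x = 0.
Proof.
move=> infF Phi_poly Phi0 x.
suff: forall (s : seq T) x, (forall t, t \notin s -> exists a, x t = h a) ->
    Phi x = 0.
  by move/(_ (enum T)); apply=> t; rewrite mem_enum.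
elim=> [|t0 s IHs] {}x xP.
  have [y xy] : exists y, forall t, x t = h (y t).
    by apply: (@fin_all_exists _ _ (fun t a => x t = h a)) => t; apply: xP.
  by rewrite (_ : x = h \o y) ?Phi0 //; apply/funext => t /=.
have [q qP] := Phi_poly x t0.
have -> : x = fun t => if t == t0 then x t0 else x t.
  by apply/funext => t; case: eqP => [->|].
rewrite qP (_ : q = 0) ?horner0 //.
apply: (@poly_eq0_unbounded _ _ h) => // a; rewrite -qP; apply: IHs => t ts.
case: eqP => [_|/eqP tt0]; first by exists a.
by apply: xP; rewrite inE negb_or tt0.
Qed.

Definition entry (S : Type) (n d : nat) (v : 'I_d -> 'M[S]_n)
    (a : 'I_#|var_index n d|) : S :=
  let: (k, i, j) := (enum_val a : var_index n d) in v k i j.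

Lemma entryE (S : Type) (n d : nat) (v : 'I_d -> 'M[S]_n) k i j :
  entry v (enum_rank ((k, i, j) : var_index n d)) = v k i j.
Proof. by rewrite /entry enum_rankK. Qed.

Lemma mxevalE (F : fieldType) (n d : nat) (f : matpoly F n d) v :
  mxeval f v = \sum_(m <- msupp f) f@_m * mmap1 (entry v) m.
Proof. by []. Qed.

Lemma mxeval_map (F K : fieldType) (h : {rmorphism F -> K}) (n d : nat)
    (f : matpoly F n d) (v : mxtuple K n d) :
  mxeval (map_mpoly h f) v = mmap h (entry v) f.
Proof.
rewrite mxevalE (perm_big _ (msupp_map_mpoly _ (fmorph_inj h))).
by apply: eq_bigr => m _; rewrite mcoeff_map_mpoly.
Qed.

Lemma mmap_entry_map (F : fieldType) (R S : comNzRingType) (h : F -> R)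
    (phi : {rmorphism R -> S}) (n d : nat) (f : matpoly F n d)
    (v : 'I_d -> 'M[R]_n) :
  phi (mmap h (entry v) f) =
  mmap (phi \o h) (entry (fun k => map_mx phi (v k))) f.
Proof.
rewrite /mmap rmorph_sum; apply: eq_bigr => m _; rewrite rmorphM; congr (_ * _).
rewrite /mmap1 rmorph_prod; apply: eq_bigr => a _; rewrite rmorphXn /entry.
by case: (enum_val a) => [[k i] j]; rewrite mxE.
Qed.

Lemma mxeval_map_mx (F K : fieldType) (h : {rmorphism F -> K}) (n d : nat)
    (f : matpoly F n d) (v : mxtuple F n d) :
  mxeval (map_mpoly h f) (fun k => map_mx h (v k)) = h (mxeval f v).
Proof. by rewrite mxeval_map (mmap_entry_map _ h). Qed.

(* [f (g v g^-1) - f v] with denominators cleared: monomialwise, [g^-1] is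
   replaced by [\adj g] and each degree is padded by powers of [\det g]; the
   extra factor [\det g] makes it vanish at singular [g] as well. *)
Definition invariance_defect (F : fieldType) (R : comNzRingType) (n d : nat)
    (h : F -> R) (f : matpoly F n d) (g : 'M[R]_n) (v : 'I_d -> 'M[R]_n) : R :=
  \det g * (\sum_(m <- msupp f) h f@_m * \det g ^+ (msize f - mdeg m) *
              mmap1 (entry (fun k => g *m v k *m \adj g)) m -
            \det g ^+ msize f * mmap h (entry v) f).

Lemma invariance_defect_map (F : fieldType) (R S : comNzRingType) (h : F -> R)
    (phi : {rmorphism R -> S}) (n d : nat) (f : matpoly F n d) g v :
  phi (invariance_defect h f g v) =
  invariance_defect (phi \o h) f (map_mx phi g) (fun k => map_mx phi (v k)).
Proof.
rewrite /invariance_defect rmorphM det_map_mx rmorphB; congr (_ * (_ - _)).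
  rewrite rmorph_sum; apply: eq_bigr => m _.
  rewrite !rmorphM rmorphXn /= -det_map_mx; congr (_ * _).
  rewrite /mmap1 rmorph_prod; apply: eq_bigr => a _; rewrite rmorphXn /entry.
  case: (enum_val a) => [[k i] j].
  by rewrite -map_mx_adj -!map_mxM [in RHS]mxE.
by rewrite rmorphM rmorphXn -det_map_mx mmap_entry_map.
Qed.

Lemma invariance_defectE (F K : fieldType) (h : {rmorphism F -> K}) (n d : nat)
    (f : matpoly F n d) (g : 'M[K]_n) (v : mxtuple K n d) :
  g \in unitmx ->
  invariance_defect h f g v = \det g ^+ (msize f).+1 *
    (mxeval (map_mpoly h f) (conj_act g v) - mxeval (map_mpoly h f) v).
Proof.
move=> gu; rewrite /invariance_defect !mxeval_map exprS -mulrA.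
congr (_ * _); rewrite mulrBr; congr (_ - _).
rewrite /mmap mulr_sumr big_seq [RHS]big_seq; apply: eq_bigr => m mf.
rewrite mulrCA -!mulrA; congr (_ * _).
rewrite -[in RHS](subnK (ltnW (msize_mdeg_lt mf))) exprD -mulrA; congr (_ * _).
rewrite mdegE -prodrXr -big_split; apply: eq_bigr => a _ /=.
rewrite -exprMn; congr (_ ^+ _).
rewrite /entry; case: (enum_val a) => [[k i] j].
rewrite /conj_act /invmx gu -scalemxAr [in RHS]mxE mulrA divff ?mul1r //.
by rewrite -unitfE -unitmxE.
Qed.

(* Over the infinite field [F], invariance is an identity between polynomials
   in the entries of [g] and [v], so it survives extension of scalars. *)
Lemma GL_invariants_map (F K : fieldType) (h : {rmorphism F -> K}) (n d : nat)
    (f : matpoly F n d) :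
  unbounded F -> @GL_invariants F n d f ->
  @GL_invariants K n d (map_mpoly h f).
Proof.
move=> infF finv.
pose T := ('I_n * 'I_n + 'I_d * 'I_n * 'I_n)%type : finType.
pose mxg (R : comNzRingType) (x : T -> R) := \matrix_(i, j) x (inl (i, j)).
pose mxv (R : comNzRingType) (x : T -> R) (k : 'I_d) :=
  \matrix_(i, j) x (inr (k, i, j)).
have key (x : T -> K) : invariance_defect h f (mxg K x) (mxv K x) = 0.
  move: x; apply: (separately_polynomial_eq0 (h := h)) => // x.
    move=> t0.
    pose x' (t : T) : {poly K} := if t == t0 then 'X else (x t)%:P.
    exists (invariance_defect (polyC \o h) f (mxg _ x') (mxv _ x')) => y.
    rewrite -[RHS]/(horner_eval y _) invariance_defect_map.
    have -> : horner_eval y \o (polyC \o h) = h.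
      by apply/funext => a /=; rewrite /horner_eval hornerC.
    have x'E t : horner_eval y (x' t) = if t == t0 then y else x t.
      by rewrite /horner_eval /x'; case: eqP; rewrite ?hornerX ?hornerC.
    congr (invariance_defect _ _ _ _).
      by apply/matrixP => i j; rewrite !mxE -x'E.
    by apply/funext => k; apply/matrixP => i j; rewrite !mxE -x'E.
  have -> : mxg K (h \o x) = map_mx h (mxg F x).
    by apply/matrixP => i j; rewrite !mxE.
  have -> : mxv K (h \o x) = fun k => map_mx h (mxv F x k).
    by apply/funext => k; apply/matrixP => i j; rewrite !mxE.
  rewrite -(invariance_defect_map (idfun : F -> F) h).
  have [gu|] := boolP (mxg F x \in unitmx).
    have := invariance_defectE (idfun : {rmorphism F -> F}) f (mxv F x) gu.
    rewrite !mxeval_map -[mmap _ _ _]/(mxeval f (conj_act _ _)).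
    rewrite -[mmap _ _ _]/(mxeval f _) => ->.
    by rewrite finv // subrr mulr0 rmorph0.
  rewrite unitmxE unitfE negbK => /eqP d0.
  by rewrite /invariance_defect d0 mul0r rmorph0.
move=> g v gu.
pose x (t : T) : K :=
  match t with inl (i, j) => g i j | inr (k, i, j) => v k i j end.
have := key x.
have -> : mxg K x = g by apply/matrixP => i j; rewrite mxE.
have -> : mxv K x = v by apply/funext => k; apply/matrixP => i j; rewrite mxE.
rewrite invariance_defectE // => /eqP; rewrite mulf_eq0 expf_eq0 /=.
by rewrite -[\det g == 0]negbK -unitfE -unitmxE gu /= subr_eq0 => /eqP.
Qed.

(** Roots are adjoined one at a time: a nonconstant divisor without smaller nonconstant divisors is
    irreducible, it acquires a root in a simple extension, and the cofactor has smaller degree. The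
    base field changes along the induction, so it is generalized together with [p]. *)
Lemma splitting_ext (F : fieldType) (p : {poly F}) :
  p != 0 ->
  exists (L : fieldType) (h : {rmorphism F -> L}) (rs : seq L),
    map_poly h p %= \prod_(z <- rs) ('X - z%:P).
Proof.
have [n] := ubnP (size p); elim: n F p => // n IHn F p szp pn0.
have [sz1|sz_gt1] := leqP (size p) 1.
  exists F, (idfun : {rmorphism F -> F}), [::]; rewrite big_nil map_poly_id //.
  by rewrite -size_poly_eq1 eqn_leq sz1 lt0n size_poly_eq0.
have [q irr_q q_p] : exists2 q, irreducible_poly q & q %| p.
  have [m] := ubnP (size p).
  elim: m p sz_gt1 {szp pn0} => // m IHm p sz_gt1 szp.
  have [[q [q1 qp ltqp]]|nq] :=
      pselect (exists q : {poly F},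
                 [/\ (1 < size q)%N, q %| p & (size q < size p)%N]).
    have [||r irr_r rq] := IHm q => //.
      by rewrite (leq_trans ltqp).
    by exists r => //; apply: dvdp_trans qp.
  exists p => //; split=> // q q1 qp; rewrite -dvdp_size_eqp //.
  have pn0 : p != 0 by rewrite -size_poly_gt0 ltnW.
  rewrite eqn_leq dvdp_leq //= leqNgt; apply/negP => ltqp; apply: nq; exists q.
  split=> //; rewrite ltn_neqAle eq_sym q1 size_poly_gt0.
  by apply: contraTneq qp => ->; rewrite dvd0p.
have [L0 _ [z qz _]] := irredp_FAdjoin irr_q.
pose h0 : {rmorphism F -> L0} := in_alg L0.
have : root (map_poly h0 p) z.
  rewrite root_factor_theorem; apply: dvdp_trans (_ : map_poly h0 q %| _).
    by rewrite -root_factor_theorem.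
  by rewrite dvdp_map.
case/factor_theorem => p1 p1E.
have p1n0 : p1 != 0.
  apply: contraTneq pn0 => p10; rewrite -(map_poly_eq0 h0) p1E p10 mul0r.
  by rewrite eqxx.
have [|//|L [h [rs hrs]]] := IHn L0 p1.
  rewrite -ltnS (leq_trans _ szp) // ltnS -(size_map_poly h0 p) p1E.
  by rewrite size_Mmonic ?monicXsubC // size_XsubC addn2.
exists L, (h \o h0 : {rmorphism F -> L}), (h z :: rs).
rewrite map_poly_comp /= p1E rmorphM /= rmorphB /= map_polyX map_polyC /=.
by rewrite big_cons mulrC eqp_mull.
Qed.

(** * Torus invariants *)

Definition diag_conj (K : fieldType) (n : nat) (a : 'I_n -> nat) (t : K) :
  'M[K]_n := diag_mx (\row_i t ^+ a i).

Lemma diag_conj_unit (K : fieldType) (n : nat) (a : 'I_n -> nat) (t : K) :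
  t != 0 -> diag_conj a t \in unitmx.
Proof.
move=> t0; rewrite unitmxE det_diag unitfE; apply/prodf_neq0 => i _.
by rewrite mxE expf_neq0.
Qed.

Lemma conj_act_diag (K : fieldType) (n d : nat) (a : 'I_n -> nat) (t : K)
    (u : mxtuple K n d) k i j :
  t != 0 ->
  conj_act (diag_conj a t) u k i j = t ^+ a i * u k i j / t ^+ a j.
Proof.
move=> t0; have gu := diag_conj_unit a t0.
have -> : conj_act (diag_conj a t) u k =
    diag_conj a t *m u k *m diag_mx (\row_i (t ^+ a i)^-1).
  rewrite /conj_act; congr (_ *m _); set h := RHS.
  have gh : diag_conj a t *m h = 1%:M.
    apply/matrixP => x y; rewrite mul_diag_mx !mxE.
    by case: eqP => [->|]; rewrite ?mulr1n ?mulr0n ?mulr0 // divff ?expf_neq0.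
  by rewrite -[invmx _]mulmx1 -gh mulmxA mulVmx // mul1mx.
by rewrite mul_mx_diag mul_diag_mx !mxE.
Qed.

(* Conjugating by [diag (t ^ a i)] multiplies the entry [(i, j)] by
   [t ^ (a i - a j)]; let [t] tend to [0]. *)
Lemma mxeval_degenerate (K : fieldType) (n d : nat) (f : matpoly K n d)
    (u : mxtuple K n d) (a : 'I_n -> nat) :
  unbounded K -> @GL_invariants K n d f ->
  (forall k i j, (a i < a j)%N -> u k i j = 0) ->
  mxeval f u = mxeval f (fun k => \matrix_(i, j) (u k i j *+ (a i == a j))).
Proof.
move=> infK finv u0.
(* The subtraction [a i - a j] truncates only where [a i < a j], and there the entry of [u] vanishes
   by [u0]; so [w] is the conjugated tuple with the parameter as a variable, and it makes sense at
   [0]. *)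
pose w (k : 'I_d) : 'M[{poly K}]_n :=
  \matrix_(i, j) ((u k i j)%:P * 'X^(a i - a j)).
pose q := mmap polyC (entry w) f.
have qE t : q.[t] =
    mxeval f (fun k => \matrix_(i, j) (u k i j * t ^+ (a i - a j))).
  rewrite -[LHS]/(horner_eval t q) /q mmap_entry_map.
  have -> : horner_eval t \o polyC = idfun.
    by apply/funext => c /=; rewrite /horner_eval hornerC.
  rewrite /mxeval /meval; congr (mmap _ (entry _) _).
  apply/funext => k; apply/matrixP => i j; rewrite !mxE.
  rewrite -[LHS]/(((u k i j)%:P * 'X^(a i - a j)).[t]).
  by rewrite hornerM hornerC hornerXn.
have q_const : q - (mxeval f u)%:P = 0.
  apply: poly_eq0_nz => // t t0; rewrite hornerD hornerN hornerC qE.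
  apply/eqP; rewrite subr_eq0 -(finv _ u (diag_conj_unit a t0)); apply/eqP.
  congr (mxeval f _); apply/funext => k; apply/matrixP => i j.
  rewrite conj_act_diag // mxE; have [lt_ij|le_ji] := ltnP (a i) (a j).
    by rewrite u0 // mulr0 !mul0r.
  by rewrite -[in RHS](subnK le_ji) exprD mulrAC mulfK ?expf_neq0 // mulrC.
have := congr1 (horner^~ 0) q_const.
rewrite /= hornerD hornerN !hornerC qE => /eqP; rewrite subr_eq0 => /eqP <-.
congr (mxeval f _); apply/funext => k; apply/matrixP => i j; rewrite !mxE.
rewrite expr0n subn_eq0; have [aij|aij|aij] := ltngtP (a i) (a j).
- by rewrite u0 // mul0r.
- by rewrite mulr0.
- by rewrite mulr1.
Qed.

(** A monomial is read as a directed multigraph on the matrix indices, each factor [x_ij(k)] being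
    an edge from [i] to [j]. *)
Definition out_degree (n d : nat) (m : 'X_{1..#|var_index n d|}) (i : 'I_n) :=
  (\sum_(x | (enum_val x).1.2 == i) m x)%N.

Definition in_degree (n d : nat) (m : 'X_{1..#|var_index n d|}) (i : 'I_n) :=
  (\sum_(x | (enum_val x).2 == i) m x)%N.

Definition balanced (n d : nat) (m : 'X_{1..#|var_index n d|}) :=
  [forall i, out_degree m i == in_degree m i].

Lemma out_degree_weight (n d : nat) (m : 'X_{1..#|var_index n d|}) a :
  (\sum_x m x * a (enum_val x).1.2 = \sum_i out_degree m i * a i)%N.
Proof.
rewrite (partition_big (fun x => (enum_val x).1.2) xpredT) //=.
apply: eq_bigr => i _; rewrite /out_degree big_distrl /=.
by apply: eq_bigr => x /eqP->.
Qed.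

Lemma in_degree_weight (n d : nat) (m : 'X_{1..#|var_index n d|}) a :
  (\sum_x m x * a (enum_val x).2 = \sum_i in_degree m i * a i)%N.
Proof.
rewrite (partition_big (fun x => (enum_val x).2) xpredT) //=.
apply: eq_bigr => i _; rewrite /in_degree big_distrl /=.
by apply: eq_bigr => x /eqP->.
Qed.

Lemma mmap1_conj_diag (K : fieldType) (n d : nat) (a : 'I_n -> nat) (t : K)
    (u : mxtuple K n d) m :
  t != 0 ->
  mmap1 (entry (conj_act (diag_conj a t) u)) m *
    t ^+ (\sum_i in_degree m i * a i)%N =
  mmap1 (entry u) m * t ^+ (\sum_i out_degree m i * a i)%N.
Proof.
move=> t0; rewrite -out_degree_weight -in_degree_weight -!prodrXr /mmap1.
rewrite -!big_split; apply: eq_bigr => x _ /=; rewrite /entry.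
case: (enum_val x) => [[k i] j] /=; rewrite conj_act_diag // ![(m x * _)%N]mulnC.
by rewrite !exprM -!exprMn divfK ?expf_neq0 // mulrC.
Qed.

(** Conjugation by [diag (t ^ a i)] multiplies a monomial by [t] to its out-weight minus its
    in-weight, so an invariant only sees the part where the two agree. *)
Lemma mxeval_weight0 (K : fieldType) (n d : nat) (f : matpoly K n d)
    (u : mxtuple K n d) (a : 'I_n -> nat) :
  unbounded K -> @GL_invariants K n d f ->
  mxeval f u = \sum_(m <- msupp f |
      (\sum_i out_degree m i * a i == \sum_i in_degree m i * a i)%N)
    f@_m * mmap1 (entry u) m.
Proof.
move=> infK finv.
pose o m := (\sum_i @out_degree n d m i * a i)%N.
pose e m := (\sum_i @in_degree n d m i * a i)%N.
(* [M] bounds every in-weight: multiplying by [t ^ M] keeps all exponents natural, and the invariant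
   part becomes the coefficient of degree [M]. *)
pose M := (\sum_(m <- msupp f) e m)%N.
have eM m : m \in msupp f -> (e m <= M)%N.
  by move=> mf; rewrite /M (big_rem m) //= leq_addr.
pose q := \sum_(m <- msupp f) (f@_m * mmap1 (entry u) m) *: 'X^(M + o m - e m).
have /(congr1 (coefp M)) : q - mxeval f u *: 'X^M = 0.
  apply: poly_eq0_nz => // t t0; rewrite hornerD hornerN hornerZ hornerXn.
  rewrite -(finv _ _ (diag_conj_unit a t0)) mxevalE horner_sum mulr_suml.
  rewrite -sumrB big_seq big1 // => m mf; rewrite hornerZ hornerXn.
  apply/eqP; rewrite subr_eq0 -!mulrA; apply/eqP; congr (_ * _).
  have := mmap1_conj_diag a u m t0; rewrite -/(o m) -/(e m) => mE.
  apply: (mulIf (expf_neq0 (e m) t0)); rewrite [RHS]mulrAC mE.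
  rewrite -!mulrA -!exprD subnK; first by rewrite addnC.
  by rewrite (leq_trans (eM _ mf)) ?leq_addr.
rewrite /= coefB coefZ coefXn eqxx mulr1 coef0 => /eqP.
rewrite subr_eq0 => /eqP <-; rewrite coef_sum [RHS]big_mkcond /=.
rewrite big_seq [RHS]big_seq; apply: eq_bigr => m mf; rewrite coefZ coefXn.
rewrite -/(o m) -/(e m) -(eqn_add2l M (o m)).
rewrite -(eqn_add2r (e m)) subnK; last by rewrite (leq_trans (eM _ mf)) ?leq_addr.
by rewrite eq_sym; case: eqP; rewrite ?mulr1 ?mulr0.
Qed.

Lemma out_degree_le (n d : nat) (m : 'X_{1..#|var_index n d|}) i :
  (out_degree m i <= mdeg m)%N.
Proof.
rewrite mdegE /out_degree [X in (_ <= X)%N](bigID (fun x => (enum_val x).1.2 == i)) /=.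
exact: leq_addr.
Qed.

Lemma in_degree_le (n d : nat) (m : 'X_{1..#|var_index n d|}) i :
  (in_degree m i <= mdeg m)%N.
Proof.
rewrite mdegE /in_degree [X in (_ <= X)%N](bigID (fun x => (enum_val x).2 == i)) /=.
exact: leq_addr.
Qed.

Lemma sum_out_degree (n d : nat) (m : 'X_{1..#|var_index n d|}) :
  (\sum_i out_degree m i = \sum_i in_degree m i)%N.
Proof.
have := out_degree_weight m (fun _ => 1%N).
have := in_degree_weight m (fun _ => 1%N).
under eq_bigr do rewrite muln1; move=> ->.
by under eq_bigr do rewrite muln1; under [RHS]eq_bigr do rewrite muln1.
Qed.

(* The weights [1, N, 0] with [N] larger than every degree separate the three
   balance conditions. *)
Lemma mxeval_balanced (K : fieldType) (d : nat) (f : matpoly K 3 d)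
    (u : mxtuple K 3 d) :
  unbounded K -> @GL_invariants K 3 d f ->
  mxeval f u = \sum_(m <- msupp f | balanced m) f@_m * mmap1 (entry u) m.
Proof.
move=> infK finv; pose N := msize f.
rewrite (@mxeval_weight0 _ _ _ _ _ (fun i => nth 0%N [:: 1%N; N; 0%N] i)) //.
rewrite big_seq_cond [RHS]big_seq_cond; apply: eq_bigl => m.
apply: andb_id2l => mf; have mN := msize_mdeg_lt mf.
have := sum_out_degree m; rewrite /balanced.
have o0 := leq_ltn_trans (out_degree_le m 0) mN.
have e0 := leq_ltn_trans (in_degree_le m 0) mN.
rewrite !big_ord_recl !big_ord0 /= => tot.
rewrite !muln0 !addn0 !muln1.
apply/eqP/forallP => [w0 i|bal]; last first.
  by rewrite (eqP (bal ord0)) (eqP (bal (lift ord0 ord0))).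
(* Modulo [N] only the degrees at index 0 survive, and they are smaller than [N]. Index 1 follows by
   cancellation, index 2 from the equality of the totals. *)
have w00 : out_degree m ord0 = in_degree m ord0.
  have := congr1 (modn^~ N) w0.
  by rewrite /= ![(_ * N)%N]mulnC !(addnC _ (N * _)%N) ![(N * _)%N]mulnC !modnMDl !modn_small.
have w01 : out_degree m (lift ord0 ord0) = in_degree m (lift ord0 ord0).
  move: w0; rewrite w00 => /addnI /eqP; rewrite eqn_pmul2r ?(leq_trans _ o0) //.
  by move/eqP.
move: tot; rewrite w00 w01 !addn0 => /addnI/addnI w02.
apply/eqP; case: i => [[|[|[|//]]] lti].
- by rewrite (_ : Ordinal _ = ord0) //; apply: val_inj.
- by rewrite (_ : Ordinal _ = lift ord0 ord0) //; apply: val_inj.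
- by rewrite (_ : Ordinal _ = lift ord0 (lift ord0 ord0)) //; apply: val_inj.
Qed.

(** * Balanced monomials and cycles *)

Lemma mmap1D (n : nat) (R : comNzRingType) (h : 'I_n -> R) m1 m2 :
  mmap1 h (m1 + m2)%MM = mmap1 h m1 * mmap1 h m2.
Proof. by apply: commr_mmap1_M => i x; apply: mulrC. Qed.

Lemma out_degreeD (n d : nat) (m1 m2 : 'X_{1..#|var_index n d|}) i :
  out_degree (m1 + m2)%MM i = (out_degree m1 i + out_degree m2 i)%N.
Proof. by rewrite -big_split; apply: eq_bigr => x _; rewrite mnmDE. Qed.

Lemma in_degreeD (n d : nat) (m1 m2 : 'X_{1..#|var_index n d|}) i :
  in_degree (m1 + m2)%MM i = (in_degree m1 i + in_degree m2 i)%N.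
Proof. by rewrite -big_split; apply: eq_bigr => x _; rewrite mnmDE. Qed.

Definition edge (n d : nat) (k : 'I_d) (i j : 'I_n) :
    'X_{1..#|var_index n d|} :=
  U_(enum_rank ((k, i, j) : var_index n d))%MM.

Lemma out_degree_edge (n d : nat) (k : 'I_d) (i j l : 'I_n) :
  out_degree (edge k i j) l = (i == l).
Proof.
rewrite /out_degree big_mkcond (bigD1 (enum_rank ((k, i, j) : var_index n d))) //=.
rewrite enum_rankK mnm1E eqxx big1 => [|x]; first by case: eqP.
by rewrite mnm1E eq_sym => /negPf->; case: ifP.
Qed.

Lemma in_degree_edge (n d : nat) (k : 'I_d) (i j l : 'I_n) :
  in_degree (edge k i j) l = (j == l).
Proof.
rewrite /in_degree big_mkcond (bigD1 (enum_rank ((k, i, j) : var_index n d))) //=.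
rewrite enum_rankK mnm1E eqxx big1 => [|x]; first by case: eqP.
by rewrite mnm1E eq_sym => /negPf->; case: ifP.
Qed.

Definition degreesE := (out_degreeD, in_degreeD, out_degree_edge, in_degree_edge).

Lemma out_edge (n d : nat) (m : 'X_{1..#|var_index n d|}) i :
  (0 < out_degree m i)%N ->
  exists k j, (0 < m (enum_rank ((k, i, j) : var_index n d)))%N.
Proof.
rewrite lt0n sum_nat_eq0 negb_forall => /existsP[x].
rewrite negb_imply -lt0n => /andP[/eqP <- mx].
case E: (enum_val x) => [[k i'] j]; exists k, j.
by rewrite /= -E enum_valK.
Qed.

Lemma edge_le_in (n d : nat) (m : 'X_{1..#|var_index n d|}) k i j :
  (0 < m (enum_rank ((k, i, j) : var_index n d)))%N -> (0 < in_degree m j)%N.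
Proof.
move=> mx; rewrite /in_degree.
rewrite (bigD1 (enum_rank ((k, i, j) : var_index n d))) /= ?enum_rankK //.
by rewrite addn_gt0 mx.
Qed.

(* A nonempty balanced digraph on three vertices contains a cycle of length at
   most 3; remove it and induct. *)
Lemma balanced_monomial (K : fieldType) (d : nat) (u v : mxtuple K 3 d) :
    (forall k i, u k i i = v k i i) ->
    (forall k l i j, u k i j * u l j i = v k i j * v l j i) ->
    (forall k l p i j h,
       u k i j * u l j h * u p h i = v k i j * v l j h * v p h i) ->
  forall m, balanced m -> mmap1 (entry u) m = mmap1 (entry v) m.
Proof.
move=> c1 c2 c3 m; have [D] := ubnP (mdeg m); elim: D m => // D IHD m mD bal.
have balE i : out_degree m i = in_degree m i by apply/eqP; move/forallP: bal.
have peel (c : 'X_{1..#|var_index 3 d|}) :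
    (c <= m)%MM -> (0 < mdeg c)%N -> balanced c ->
    mmap1 (entry u) c = mmap1 (entry v) c ->
    mmap1 (entry u) m = mmap1 (entry v) m.
  move=> cm c0 balc cE; have mE := submK cm; rewrite -mE !mmap1D cE IHD //.
    by move: mD; rewrite -{1}mE mdegD; lia.
  apply/forallP => i; rewrite -(eqn_add2r (out_degree c i)) -out_degreeD.
  by rewrite (eqP (forallP balc i)) -in_degreeD mE balE.
have edgeE (w : mxtuple K 3 d) k i j : mmap1 (entry w) (edge k i j) = w k i j.
  by rewrite mmap1U entryE.
have [->|m0] := eqVneq m 0%MM; first by rewrite !mmap11.
pose has_edge k i j := (0 < m (enum_rank ((k, i, j) : var_index 3 d)))%N.
have loop k i : has_edge k i i -> mmap1 (entry u) m = mmap1 (entry v) m.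
  move=> mx; apply: (peel (edge k i i)); rewrite ?edgeE ?mdeg1 //.
    apply/mnm_lepP => x; rewrite mnm1E; case: eqP => // <-; exact: mx.
  by apply/forallP => l; rewrite !degreesE.
have succ k i j : has_edge k i j -> exists l h, has_edge l j h.
  by move/edge_le_in; rewrite -balE => /out_edge.
have two k l i j : i != j -> has_edge k i j -> has_edge l j i ->
    mmap1 (entry u) m = mmap1 (entry v) m.
  move=> ij mx my.
  apply: (peel (edge k i j + edge l j i)%MM); rewrite ?mmap1D ?edgeE ?mdegD ?mdeg1 //.
    apply/mnm_lepP => x; rewrite mnmDE !mnm1E.
    case: eqP => [<-|_]; last by case: eqP => [<-|].
    by rewrite (inj_eq enum_rank_inj) !xpair_eqE (eq_sym j) (negPf ij) !andbF.
  by apply/forallP => h; rewrite !degreesE addnC.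
have three k l p i j h : i != j -> j != h -> h != i ->
    has_edge k i j -> has_edge l j h -> has_edge p h i ->
    mmap1 (entry u) m = mmap1 (entry v) m.
  move=> ij jh hi mx my mz.
  apply: (peel (edge k i j + edge l j h + edge p h i)%MM);
    rewrite ?mmap1D ?edgeE ?mdegD ?mdeg1 //.
    apply/mnm_lepP => x; rewrite !mnmDE !mnm1E.
    case: eqP => [<-|_].
      rewrite !(inj_eq enum_rank_inj) !xpair_eqE (eq_sym j i) (negPf ij) (negPf hi).
      by rewrite !andbF /=.
    case: eqP => [<-|_].
      by rewrite !(inj_eq enum_rank_inj) !xpair_eqE (eq_sym h j) (negPf jh) !andbF.
    by case: eqP => [<-|].
  by apply/forallP => q; rewrite !degreesE; lia.
have [x mx] : exists x, (0 < m x)%N.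
  by move: m0; rewrite -mdeg_eq0 mdegE sum_nat_eq0 negb_forall => /existsP[x];
     rewrite -lt0n; exists x.
move: mx; rewrite -(enum_valK x); case: (enum_val x) => [[k i] j] kij.
have [ij|ij] := eqVneq i j; first by apply: (loop k i); rewrite {2}ij.
have [l [h ljh]] := succ _ _ _ kij.
have [jh|jh] := eqVneq j h; first by apply: (loop l j); rewrite {2}jh.
have [hi|hi] := eqVneq h i; first by apply: (two k l i j) => //; rewrite -hi.
have [p [q phq]] := succ _ _ _ ljh.
have [hq|hq] := eqVneq h q; first by apply: (loop p h); rewrite {2}hq.
have [qj|qj] := eqVneq q j; first by apply: (two l p j h) => //; rewrite -qj.
(* There are only three vertices, and [q] is neither [h] nor [j]: the path closes at [i]. *)
have qi : q = i.
  apply/val_inj; move: ij jh hi hq qj; rewrite -!val_eqE /=.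
  case: i j h q {kij ljh phq} => [i ?] [j ?] [h ?] [q ?] /=; lia.
by apply: (three k l p i j h) => //; rewrite -qi.
Qed.

(** * Identities for 3 x 3 matrices *)

(** Nine explicit entries reduce matrix identities to [ring] goals. *)
Definition mk3 (R : Type) (a b c d e f g h i : R) : 'M[R]_3 :=
  \matrix_(x < 3, y < 3) nth a (nth [::] [:: [:: a; b; c]; [:: d; e; f]; [:: g; h; i]] x) y.

Section ThreeByThree.
Variable R : comNzRingType.
Implicit Types A B X Y Z : 'M[R]_3.

(** The sum of the principal 2 by 2 minors, in entries so that [ring] applies; [lift 0 1] is the
    index 2. It is identified with [sigma 2] in [sigma2_s2]. *)
Definition s2 A : R :=
  A 0 0 * A 1 1 - A 0 1 * A 1 0 + A 0 0 * A (lift 0 1) (lift 0 1)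
  - A 0 (lift 0 1) * A (lift 0 1) 0 + A 1 1 * A (lift 0 1) (lift 0 1)
  - A 1 (lift 0 1) * A (lift 0 1) 1.

Lemma mk3_eta A : exists a b c d e f g h i, A = mk3 a b c d e f g h i.
Proof.
exists (A 0 0), (A 0 1), (A 0 (lift 0 1)), (A 1 0), (A 1 1), (A 1 (lift 0 1)),
  (A (lift 0 1) 0), (A (lift 0 1) 1), (A (lift 0 1) (lift 0 1)).
apply/matrixP => -[[|[|[|//]]] ?] [[|[|[|//]]] ?]; rewrite mxE /=;
  by congr (A _ _); apply: val_inj.
Qed.

Lemma eq_mk3 (a b c d e f g h i a' b' c' d' e' f' g' h' i' : R) :
  [/\ a = a', b = b' & c = c'] -> [/\ d = d', e = e' & f = f'] ->
  [/\ g = g', h = h' & i = i'] ->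
  mk3 a b c d e f g h i = mk3 a' b' c' d' e' f' g' h' i'.
Proof. by move=> [-> -> ->] [-> -> ->] [-> -> ->]. Qed.

Lemma add_mk3 a b c d e f g h i a' b' c' d' e' f' g' h' i' :
  mk3 a b c d e f g h i + mk3 a' b' c' d' e' f' g' h' i' =
  mk3 (a + a') (b + b') (c + c') (d + d') (e + e') (f + f')
    (g + g') (h + h') (i + i') :> 'M[R]_3.
Proof.
by apply/matrixP => -[[|[|[|//]]] ?] [[|[|[|//]]] ?]; rewrite !mxE.
Qed.

Lemma opp_mk3 a b c d e f g h i :
  - mk3 a b c d e f g h i =
  mk3 (- a) (- b) (- c) (- d) (- e) (- f) (- g) (- h) (- i) :> 'M[R]_3.
Proof.
by apply/matrixP => -[[|[|[|//]]] ?] [[|[|[|//]]] ?]; rewrite !mxE.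
Qed.

Lemma scale_mk3 z a b c d e f g h i :
  z *: mk3 a b c d e f g h i =
  mk3 (z * a) (z * b) (z * c) (z * d) (z * e) (z * f)
    (z * g) (z * h) (z * i) :> 'M[R]_3.
Proof.
by apply/matrixP => -[[|[|[|//]]] ?] [[|[|[|//]]] ?]; rewrite !mxE.
Qed.

Lemma scalar_mk3 z : z%:M = mk3 z 0 0 0 z 0 0 0 z :> 'M[R]_3.
Proof.
by apply/matrixP => -[[|[|[|//]]] ?] [[|[|[|//]]] ?]; rewrite !mxE.
Qed.

Lemma mul_mk3 a b c d e f g h i a' b' c' d' e' f' g' h' i' :
  mk3 a b c d e f g h i *m mk3 a' b' c' d' e' f' g' h' i' =
  mk3 (a * a' + b * d' + c * g') (a * b' + b * e' + c * h')
      (a * c' + b * f' + c * i')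
      (d * a' + e * d' + f * g') (d * b' + e * e' + f * h')
      (d * c' + e * f' + f * i')
      (g * a' + h * d' + i * g') (g * b' + h * e' + i * h')
      (g * c' + h * f' + i * i') :> 'M[R]_3.
Proof.
by apply/matrixP => -[[|[|[|//]]] ?] [[|[|[|//]]] ?];
  rewrite !mxE !big_ord_recl big_ord0 !mxE addr0 addrA.
Qed.

Lemma tr_mk3 a b c d e f g h i : \tr (mk3 a b c d e f g h i : 'M[R]_3) = a + e + i.
Proof. by rewrite /mxtrace !big_ord_recl big_ord0 !mxE addr0 addrA. Qed.

Lemma s2_mk3 a b c d e f g h i :
  s2 (mk3 a b c d e f g h i) =
  a * e - b * d + a * i - c * g + e * i - f * h.
Proof. by rewrite /s2 !mxE. Qed.

Lemma det_mk3 a b c d e f g h i :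
  \det (mk3 a b c d e f g h i : 'M[R]_3) =
  a * (e * i - f * h) - b * (d * i - f * g) + c * (d * h - e * g).
Proof.
rewrite (expand_det_row _ ord0) !big_ord_recl big_ord0 /cofactor.
rewrite !(expand_det_row _ ord0) !big_ord_recl !big_ord0 /cofactor !det_mx11.
rewrite !mxE /= /bump /=; ring.
Qed.

Definition mk3E := (mul_mk3, add_mk3, opp_mk3, scale_mk3, scalar_mk3).
Definition inv3E := (tr_mk3, s2_mk3, det_mk3).

End ThreeByThree.

Ltac mx3 M := let a := fresh "a" in let b := fresh "b" in let c := fresh "c" in
  let d := fresh "d" in let e := fresh "e" in let f := fresh "f" in
  let g := fresh "g" in let h := fresh "h" in let i := fresh "i" in
  let E := fresh "E" in
  have [a [b [c [d [e [f [g [h [i E]]]]]]]]] := mk3_eta M; subst M.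
Ltac ring3 := apply: eq_mk3; split; ring.

Section ThreeByThreeIdentities.
Variable R : comNzRingType.
Implicit Types A B X Y Z : 'M[R]_3.

Lemma char_poly3 A :
  char_poly A = 'X^3 - (\tr A)%:P * 'X^2 + (s2 A)%:P * 'X - (\det A)%:P.
Proof.
mx3 A; rewrite /char_poly.
have -> : char_poly_mx (mk3 a b c d e f g h i) =
    mk3 ('X - a%:P) (- b%:P) (- c%:P) (- d%:P) ('X - e%:P) (- f%:P)
        (- g%:P) (- h%:P) ('X - i%:P).
  apply/matrixP => -[[|[|[|//]]] ?] [[|[|[|//]]] ?];
    by rewrite !mxE /= ?mulr1n ?mulr0n ?sub0r.
by rewrite !inv3E; ring.
Qed.

Lemma sigma2_s2 A : sigma 2 A = s2 A.
Proof.
rewrite /sigma char_poly3 sqrrN expr1n mul1r.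
rewrite coefB coefD coefB coefXn coefCM coefXn coefMX coefC coefC /=.
by rewrite mulr0 !subr0 add0r.
Qed.

Lemma det_scalar_sub A (t : R) :
  \det (t%:M - A) = t ^+ 3 - \tr A * t ^+ 2 + s2 A * t - \det A.
Proof. by mx3 A; rewrite !mk3E !inv3E; ring. Qed.

Lemma cayley_hamilton3 A :
  A *m A *m A = \tr A *: (A *m A) - s2 A *: A + (\det A)%:M.
Proof. mx3 A; rewrite !inv3E !mk3E; ring3. Qed.

Lemma adj3 A : \adj A = A *m A - \tr A *: A + (s2 A)%:M.
Proof.
mx3 A; rewrite !inv3E !mk3E.
apply/matrixP => -[[|[|[|//]]] ?] [[|[|[|//]]] ?];
  rewrite !mxE /cofactor (expand_det_row _ ord0) !big_ord_recl !big_ord0 /cofactor !det_mx11;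
  rewrite !mxE /= /bump /=; ring.
Qed.

(** The part of the Cayley-Hamilton identity of degree 2 in [X] and 1 in [Y], solved for [X Y X];
    the scalar term is [\tr (\adj X *m Y)]. *)
Lemma mulmx_sandwich X Y :
  X *m Y *m X = - (X *m X *m Y) - Y *m X *m X + \tr X *: (X *m Y + Y *m X)
    + \tr Y *: (X *m X) - s2 X *: Y - (\tr X * \tr Y - \tr (X *m Y)) *: X
    + (\tr (X *m X *m Y) - \tr X * \tr (X *m Y) + s2 X * \tr Y)%:M.
Proof. mx3 X; mx3 Y; rewrite !mk3E !inv3E; ring3. Qed.

(** [s2] is the trace of the adjugate, and [\adj (X *m Y) = \adj Y *m \adj X]; both adjugates are
    written as polynomials in their matrix. Thus [s2] of a product becomes a trace of a word
    combination in every characteristic. *)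
Lemma s2_mul X Y :
  s2 (X *m Y) = \tr ((Y *m Y - \tr Y *: Y + (s2 Y)%:M) *m
                     (X *m X - \tr X *: X + (s2 X)%:M)).
Proof. by mx3 X; mx3 Y; rewrite !inv3E !mk3E !inv3E; ring. Qed.

Lemma s2_sqr X : s2 (X *m X) = s2 X ^+ 2 - \tr X * \det X *+ 2.
Proof. by mx3 X; rewrite !mk3E !inv3E; ring. Qed.

Lemma tr_sqr X : \tr (X *m X) = \tr X ^+ 2 - s2 X *+ 2.
Proof. by mx3 X; rewrite !mk3E !inv3E; ring. Qed.

Lemma s2D X Y : s2 (X + Y) = s2 X + s2 Y + \tr X * \tr Y - \tr (X *m Y).
Proof. by mx3 X; mx3 Y; rewrite !mk3E !inv3E; ring. Qed.

Lemma s2Z (z : R) X : s2 (z *: X) = z ^+ 2 * s2 X.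
Proof. by mx3 X; rewrite !mk3E !inv3E; ring. Qed.

(** The mixed terms are [\tr (\adj X *m Y)] and [\tr (X *m \adj Y)]. *)
Lemma det3D X Y :
  \det (X + Y) = \det X + \det Y
    + \tr ((X *m X - \tr X *: X + (s2 X)%:M) *m Y)
    + \tr (X *m (Y *m Y - \tr Y *: Y + (s2 Y)%:M)).
Proof. by mx3 X; mx3 Y; rewrite !inv3E !mk3E !inv3E; ring. Qed.

End ThreeByThreeIdentities.

(** * Traces of words *)

Lemma tr_cube (R : comNzRingType) (X Z : 'M[R]_3) :
  \tr (X *m X *m X *m Z) =
  \tr X * \tr (X *m X *m Z) - s2 X * \tr (X *m Z) + \det X * \tr Z.
Proof.
rewrite cayley_hamilton3 mulmxDl mulmxBl mul_scalar_mx -!scalemxAl.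
by rewrite mxtraceD raddfB /= !mxtraceZ.
Qed.

Lemma tr_sandwich (R : comNzRingType) (X Y Z : 'M[R]_3) :
  \tr (X *m Y *m X *m Z) =
  - \tr (X *m X *m Y *m Z) - \tr (Y *m X *m X *m Z)
  + \tr X * (\tr (X *m Y *m Z) + \tr (Y *m X *m Z))
  + \tr Y * \tr (X *m X *m Z) - s2 X * \tr (Y *m Z)
  - (\tr X * \tr Y - \tr (X *m Y)) * \tr (X *m Z)
  + (\tr (X *m X *m Y) - \tr X * \tr (X *m Y) + s2 X * \tr Y) * \tr Z.
Proof.
rewrite mulmx_sandwich !(mulmxDl, mulmxBl, mulNmx) mul_scalar_mx -!scalemxAl.
by rewrite mulmxDl !(mxtraceD, raddfB, raddfN, mxtraceZ) /= !mxtraceZ.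
Qed.

Fixpoint weval (R : comNzRingType) (A B : 'M[R]_3) (w : seq bool) : 'M[R]_3 :=
  if w is x :: w' then (if x then A else B) *m weval A B w' else 1%:M.

Lemma weval_cat (R : comNzRingType) (A B : 'M[R]_3) w1 w2 :
  weval A B (w1 ++ w2) = weval A B w1 *m weval A B w2.
Proof. by elim: w1 => [|x w1 IH] /=; rewrite ?mul1mx // IH mulmxA. Qed.

(* The word [a^i1 b^j1 a^i2 b^j2 ...], where zero exponents are allowed. *)
Definition block_word (bs : seq (nat * nat)) : seq bool :=
  flatten [seq nseq p.1 true ++ nseq p.2 false | p <- bs].

Lemma block_word_cons i j bs :
  block_word ((i, j) :: bs) = nseq i true ++ nseq j false ++ block_word bs.
Proof. by rewrite /block_word /= catA. Qed.

Lemma block_word_cat bs1 bs2 :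
  block_word (bs1 ++ bs2) = block_word bs1 ++ block_word bs2.
Proof. by rewrite /block_word map_cat flatten_cat. Qed.

Lemma block_word_merge_right bs1 bs2 p r q :
  block_word (bs1 ++ (p, r) :: (0, q)%N :: bs2) =
  block_word (bs1 ++ (p, (r + q)%N) :: bs2).
Proof.
by rewrite !block_word_cat !block_word_cons /= nseqD !catA.
Qed.

Lemma block_word_merge_left bs p i q :
  block_word ((i, 0)%N :: (p, q) :: bs) = block_word (((i + p)%N, q) :: bs).
Proof. by rewrite !block_word_cons /= nseqD !catA. Qed.

Section WordTraces.
Variables (R : comNzRingType) (A B A' B' : 'M[R]_3).

Definition eq_invariants (P P' : 'M[R]_3) :=
  [/\ \tr P = \tr P', s2 P = s2 P' & \det P = \det P'].

Definition eq_tr (w : seq bool) := \tr (weval A B w) = \tr (weval A' B' w).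

Hypotheses (hA : eq_invariants A A') (hB : eq_invariants B B').

Hypotheses (hAB : eq_tr [:: true; false]) (hAAB : eq_tr [:: true; true; false])
  (hABB : eq_tr [:: true; false; false])
  (hAABB : eq_tr [:: true; true; false; false])
  (hAABBAB : eq_tr [:: true; true; false; false; true; false]).

Lemma eq_tr_rot w1 w2 : eq_tr (w1 ++ w2) -> eq_tr (w2 ++ w1).
Proof. by rewrite /eq_tr !weval_cat mxtrace_mulC [in RHS]mxtrace_mulC. Qed.

Lemma eq_invariants_letter (x : bool) :
  eq_invariants (if x then A else B) (if x then A' else B').
Proof. by case: x. Qed.

Section Step.
Variable n : nat.
Hypothesis IHn : forall w, (size w < n)%N -> eq_tr w.

Lemma eq_tr_cube x w : size w = (n - 3)%N -> (2 < n)%N -> eq_tr [:: x, x, x & w].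
Proof.
move=> sw n3; have [ht hs hd] := eq_invariants_letter x.
have := IHn (_ : size [:: x, x & w] < n)%N.
have := IHn (_ : size (x :: w) < n)%N.
have := IHn (_ : size w < n)%N.
rewrite /eq_tr /= !mulmxA !tr_cube ht hs hd.
by move=> -> /=; [move=> -> /=; [move=> -> //|]|]; lia.
Qed.

(** Modulo shorter words, the trace of [XYXZ] is minus those of [XXYZ] and [YXXZ]. The assumption on
    [s2] stands apart because [s2] is not a polynomial in traces in characteristic 2; it is met
    below with [xs] a power of one letter. *)
Lemma eq_tr_sandwich (xs y z : seq bool) :
    s2 (weval A B xs) = s2 (weval A' B' xs) ->
    (0 < size xs)%N -> (0 < size y)%N -> (0 < size z)%N ->
    (size xs + size xs + size y + size z)%N = n ->
    eq_tr (xs ++ xs ++ y ++ z) -> eq_tr (y ++ xs ++ xs ++ z) ->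
  eq_tr (xs ++ y ++ xs ++ z).
Proof.
move=> hs x0 y0 z0 sz.
have := IHn (_ : size (xs ++ y ++ z) < n)%N.
have := IHn (_ : size (y ++ xs ++ z) < n)%N.
have := IHn (_ : size y < n)%N.
have := IHn (_ : size (xs ++ xs ++ z) < n)%N.
have := IHn (_ : size (y ++ z) < n)%N.
have := IHn (_ : size xs < n)%N.
have := IHn (_ : size (xs ++ y) < n)%N.
have := IHn (_ : size (xs ++ z) < n)%N.
have := IHn (_ : size (xs ++ xs ++ y) < n)%N.
have := IHn (_ : size z < n)%N.
rewrite /eq_tr !size_cat !weval_cat !mulmxA !tr_sandwich hs.
do 10! (move/(_ ltac:(lia)) => ->).
by move=> -> ->.
Qed.

Section Blocks.
Variable k : nat.
Hypothesis IHk :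
  forall bs, (size bs <= k)%N -> size (block_word bs) = n -> eq_tr (block_word bs).

Lemma eq_tr_merge bs1 bs2 q :
    (0 < size bs1)%N -> (size bs1 + size bs2 = k)%N ->
    size (block_word (bs1 ++ (0, q)%N :: bs2)) = n ->
  eq_tr (block_word (bs1 ++ (0, q)%N :: bs2)).
Proof.
case/lastP: bs1 => // bs1 [p r] _ /=; rewrite cat_rcons block_word_merge_right.
by rewrite size_rcons => sk sn; apply: IHk => //; rewrite size_cat /=; lia.
Qed.

(** With [X = a^i] the two equal blocks come together. For [i = 1] they fuse to [a^2] and the word
    has one block less; for [i = 2] they fuse to [a^4], which Cayley-Hamilton shortens. *)
Lemma eq_tr_equal_exponents i j q mid rest :
    (0 < i < 3)%N -> (0 < j)%N -> (0 < q)%N ->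
    (size mid + size rest).+1 = k ->
    size (block_word ((i, j) :: mid ++ (i, q) :: rest)) = n ->
  eq_tr (block_word ((i, j) :: mid ++ (i, q) :: rest)).
Proof.
move=> i03 j0 q0 sk.
pose y := nseq j false ++ block_word mid.
pose z := nseq q false ++ block_word rest.
rewrite block_word_cons block_word_cat block_word_cons.
rewrite (_ : _ ++ _ = nseq i true ++ y ++ nseq i true ++ z); last first.
  by rewrite /y /z !catA.
rewrite !size_cat !size_nseq => sn.
have szy : size y = (j + size (block_word mid))%N by rewrite size_cat size_nseq.
have szz : size z = (q + size (block_word rest))%N by rewrite size_cat size_nseq.
apply: eq_tr_sandwich; rewrite ?size_nseq //; try lia.
- have [ht hs hd] := hA; case: i {sn} i03 => [|[|[|]]] //= _; rewrite !mulmx1 //.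
  by rewrite !s2_sqr ht hs hd.
- case: i sn i03 => [|[|[|]]] // sn _.
    suff: eq_tr (block_word (((2, j)%N :: mid) ++ (0, q)%N :: rest)).
      by rewrite block_word_cat !block_word_cons /y /z /= -!catA.
    apply: eq_tr_merge; [by [] | by move: sk => /=; lia | move: sn].
    rewrite block_word_cons block_word_cat block_word_cons /= /y /z.
    by rewrite !size_cat !size_nseq; lia.
  by clearbody y z; apply: (@eq_tr_cube true (true :: y ++ z)); rewrite /= ?size_cat; lia.
- apply: (@eq_tr_rot (nseq i true ++ nseq i true ++ z) y); rewrite -2!catA.
  case: i sn i03 => [|[|[|]]] // sn _.
    suff: eq_tr (block_word (((2, q)%N :: rest) ++ (0, j)%N :: mid)).
      by rewrite block_word_cat !block_word_cons /y /z /= -!catA.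
    apply: eq_tr_merge; [by [] | by move: sk => /=; lia | move: sn].
    rewrite block_word_cons block_word_cat block_word_cons /= /y /z.
    by rewrite !size_cat !size_nseq; lia.
  by clearbody y z; apply: (@eq_tr_cube true (true :: z ++ y)); rewrite /= ?size_cat; lia.
Qed.

Lemma eq_tr_block_rot bs1 bs2 :
  eq_tr (block_word (bs1 ++ bs2)) -> eq_tr (block_word (bs2 ++ bs1)).
Proof. by rewrite !block_word_cat; apply: eq_tr_rot. Qed.

Lemma size_block_word_rot bs1 bs2 :
  size (block_word (bs1 ++ bs2)) = size (block_word (bs2 ++ bs1)).
Proof. by rewrite !block_word_cat !size_cat addnC. Qed.

(** Exponents above 2 shorten the word and zero exponents merge blocks, up to rotation. Once all
    exponents are 1 or 2, any three blocks contain two equal exponents of [a]; what resists is two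
    blocks with distinct exponents in each letter, that is, words of degree 6. *)
Lemma eq_tr_block_step bs :
  size bs = k.+1 -> size (block_word bs) = n -> eq_tr (block_word bs).
Proof.
move=> sk sn.
have [/hasP[[i j] ijbs /= /orP[i3|j3]]|] :=
    boolP (has (fun p => (2 < p.1) || (2 < p.2))%N bs).
- move: sn; case/splitPr: ijbs => bs1 bs2; rewrite size_block_word_rot => sn.
  apply: (@eq_tr_block_rot ((i, j) :: bs2)); move: sn => /=.
  case: i i3 => [|[|[|i]]] // _; rewrite block_word_cons /= => sn.
  by apply: eq_tr_cube; lia.
- move: sn; case/splitPr: ijbs => bs1 bs2; rewrite size_block_word_rot => sn.
  apply: (@eq_tr_block_rot ((i, j) :: bs2)); move: sn => /=.
  rewrite block_word_cons => sn; apply: (@eq_tr_rot _ (nseq i true)).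
  case: j j3 sn => [|[|[|j]]] // _ /=; rewrite !size_cat /= => sn.
  by apply: eq_tr_cube; move: sn; rewrite ?size_cat ?size_nseq /=; lia.
rewrite -all_predC => /allP /= small.
have [k0|k0] := posnP k.
  case: bs sk sn small => [|[i j] [|]] //=; rewrite k0 // => _ _ /(_ (i, j)).
  rewrite inE eqxx negb_or -!leqNgt => /(_ isT) /andP[] /= i2 j2.
  have [htA hsA hdA] := hA; have [htB hsB hdB] := hB.
  case: i i2 => [|[|[|]]] // _; case: j j2 => [|[|[|]]] // _ //.
  - by rewrite /eq_tr /= !mulmx1.
  - by rewrite /eq_tr /= !mulmx1 !tr_sqr htB hsB.
  - by rewrite /eq_tr /= !mulmx1.
  - by rewrite /eq_tr /= !mulmx1 !tr_sqr htA hsA.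
have [/hasP[[i j] ijbs /= /orP[/eqP i0|/eqP j0]]|] :=
    boolP (has (fun p => (p.1 == 0) || (p.2 == 0))%N bs).
- rewrite {i}i0 in ijbs; move: sn sk {small}.
  case/splitPr: ijbs => bs1 bs2; rewrite size_cat /=.
  case: bs1 => [|p bs1] sn sk; last by apply: eq_tr_merge => //=; move: sk => /=; lia.
  case/lastP: bs2 sn sk => [|bs2 p]; first by move=> _ /=; lia.
  rewrite -cats1 => sn sk; apply: (@eq_tr_block_rot [:: p] ((0, j)%N :: bs2)).
  apply: eq_tr_merge; first by [].
    by move: sk; rewrite /= size_cat /=; lia.
  by rewrite (size_block_word_rot [:: p] ((0, j)%N :: bs2)).
- rewrite {j}j0 in ijbs; move: sn sk {small}.
  case/splitPr: ijbs => bs1 bs2; rewrite size_block_word_rot => sn sk.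
  have {}sk : size (((i, 0)%N :: bs2) ++ bs1) = k.+1.
    by rewrite -sk !size_cat addnC.
  apply: (@eq_tr_block_rot ((i, 0)%N :: bs2)); move: sn sk; rewrite cat_cons.
  case: (bs2 ++ bs1) => [|[p q] bs'] /=; first by move=> _; lia.
  by rewrite block_word_merge_left => sn [sk]; apply: IHk => //=; lia.
rewrite -all_predC => /allP /= pos.
have expo p : p \in bs -> (0 < p.1 < 3)%N /\ (0 < p.2 < 3)%N.
  case: p => i j pbs; move: (small _ pbs) (pos _ pbs) => /=.
  rewrite !negb_or -!leqNgt -!lt0n !ltnS.
  by move=> /andP[-> ->] /andP[-> ->].
move: sk sn expo {small pos}; case: bs => [|[i1 j1] [|[i2 j2] bs]] //=; first lia.
move=> [sk] sn expo.
have [/= i1P j1P] := expo (i1, j1) (mem_head _ _).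
have [/= i2P j2P] : (0 < i2 < 3)%N /\ (0 < j2 < 3)%N.
  by apply: (expo (i2, j2)); rewrite !inE eqxx orbT.
have [i12|i12] := eqVneq i1 i2.
  rewrite -i12 in sn *; apply: (@eq_tr_equal_exponents _ _ _ [::]) => //=; lia.
case: bs sk sn expo => [|[i3 j3] bs] sk sn expo; last first.
  have [/= i3P j3P] : (0 < i3 < 3)%N /\ (0 < j3 < 3)%N.
    by apply: (expo (i3, j3)); rewrite !inE eqxx !orbT.
  have [i13|i13] := eqVneq i1 i3.
    rewrite -i13 in sn *.
    by apply: (@eq_tr_equal_exponents _ _ _ [:: (i2, j2)]) => //=; lia.
  have i23 : i2 = i3 by lia.
  rewrite -i23 in sn *; apply: (@eq_tr_block_rot [:: (i2, j2), (i2, j3) & bs] [:: (i1, j1)]).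
  have sn' : size (block_word ([:: (i2, j2), (i2, j3) & bs] ++ [:: (i1, j1)])) = n.
    by rewrite size_block_word_rot.
  apply: (@eq_tr_equal_exponents i2 j2 j3 [::] (bs ++ [:: (i1, j1)])) => //.
  - by case/andP: j2P.
  - by case/andP: j3P.
  - by move: sk; rewrite size_cat /=; lia.
(* Now [X = b^j1]: the two powers of [a] meet and form [a^3], since [i1] and [i2] are 1 and 2 in
   some order. *)
have [j12|j12] := eqVneq j1 j2.
  rewrite -j12 in sn *; move: sn; rewrite !block_word_cons /= cats0 => sn.
  have {sn}sn : (i1 + (j1 + (i2 + j1)))%N = n.
    by rewrite -sn !size_cat !size_nseq.
  apply: (@eq_tr_rot _ (nseq i1 true)); rewrite -!catA.
  apply: eq_tr_sandwich; rewrite ?size_nseq; try lia.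
  - have [ht hs hd] := hB; case: j1 {expo sn j12} j1P => [|[|[|]]] //= _; rewrite !mulmx1 //.
    by rewrite !s2_sqr ht hs hd.
  - case: j1 {expo} j1P sn j12 => [|[|[|]]] // _ sn _; last first.
      by apply: eq_tr_cube; rewrite /= ?size_cat ?size_nseq; lia.
    apply: (@eq_tr_rot (nseq i2 true ++ nseq i1 true) [:: false; false]).
    rewrite -nseqD (_ : i2 + i1 = 3)%N; last by lia.
    by apply: eq_tr_cube; rewrite /=; lia.
  apply: (@eq_tr_rot (nseq j1 false ++ nseq j1 false ++ nseq i1 true) (nseq i2 true)).
  rewrite catA -catA.
  apply: (@eq_tr_rot (nseq i1 true ++ nseq i2 true) (nseq j1 false ++ nseq j1 false)).
  rewrite -nseqD (_ : i1 + i2 = 3)%N; last by lia.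
  by apply: eq_tr_cube; rewrite /= ?size_cat ?size_nseq; lia.
have n6 : n = 6%N.
  by rewrite -sn !block_word_cons /= cats0 !size_cat !size_nseq; lia.
(* After rotation to [ababba], take [X = a], [Y = b], [Z = bba]: what remains is [aabbba], which
   contains a cube, and [baabba], a rotation of [aabbab]. Hence a single generator accounts for both
   cyclic classes of degree 6. *)
have aababb : eq_tr [:: true; true; false; true; false; false].
  apply: (@eq_tr_rot [:: true; false; true; false; false] [:: true]).
  apply: (@eq_tr_rot [::] [:: true; false; true; false; false; true]) => /=.
  apply: (@eq_tr_sandwich [:: true] [:: false] [:: false; false; true]) => //=.
  - by have [_ hs _] := hA; rewrite !mulmx1.
  - apply: (@eq_tr_rot [:: true] [:: true; true; false; false; false]).
    by apply: eq_tr_cube; rewrite n6.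
  - by apply: (@eq_tr_rot [:: true; true; false; false; true] [:: false]).
have abbaab : eq_tr [:: true; false; false; true; true; false].
  by apply: (@eq_tr_rot [:: true; true; false] [:: true; false; false]).
have abaabb : eq_tr [:: true; false; true; true; false; false].
  by apply: (@eq_tr_rot [:: true; true; false; false] [:: true; false]).
have [[-> ->]|[-> ->]] : (i1 = 1 /\ i2 = 2 \/ i1 = 2 /\ i2 = 1)%N by lia.
  have [[-> ->]|[-> ->]] : (j1 = 1 /\ j2 = 2 \/ j1 = 2 /\ j2 = 1)%N by lia.
    exact: abaabb.
  exact: abbaab.
have [[-> ->]|[-> ->]] : (j1 = 1 /\ j2 = 2 \/ j1 = 2 /\ j2 = 1)%N by lia.
  exact: aababb.
exact: hAABBAB.
Qed.

End Blocks.

End Step.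

Lemma eq_tr_word w : eq_tr w.
Proof.
have [n] := ubnP (size w); elim: n w => // n IHn w; rewrite ltnS => wn.
have IHw w' : (size w' < size w)%N -> eq_tr w'.
  by move=> w'w; apply: IHn; lia.
have blocks k bs :
    (size bs <= k)%N -> size (block_word bs) = size w -> eq_tr (block_word bs).
  elim: k bs => [|k IHk] bs sk sw; first by case: bs sk {sw}.
  have [sk'|sk'] := leqP (size bs) k; first exact: IHk.
  by apply: (eq_tr_block_step IHw IHk) => //; lia.
have wE : block_word [seq if x then (1, 0)%N else (0, 1)%N | x <- w] = w.
  by elim: (w) => //= -[] w' IH; rewrite block_word_cons IH.
by rewrite -wE; apply: (blocks (size w)); rewrite ?size_map ?wE.
Qed.

End WordTraces.

(** * Pairs with a common separable element *)

(** The subalgebra generated by the pairs [(u k, v k)]. Generators multiply on the left only, so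
    that inductions follow words; closure under all products is [pairM]. *)
Inductive pair_alg (R : comNzRingType) (n d : nat) (u v : 'I_d -> 'M[R]_n) :
    'M[R]_n -> 'M[R]_n -> Prop :=
  | PairOne : pair_alg u v 1%:M 1%:M
  | PairGen k P P' : pair_alg u v P P' -> pair_alg u v (u k *m P) (v k *m P')
  | PairLin c P P' Q Q' : pair_alg u v P P' -> pair_alg u v Q Q' ->
      pair_alg u v (c *: P + Q) (c *: P' + Q').

Section PairAlgebra.
Variables (R : comNzRingType) (n d : nat) (u v : 'I_d -> 'M[R]_n).
Local Notation E := (pair_alg u v).

Lemma pair_gen k : E (u k) (v k).
Proof. by have := PairGen k (PairOne u v); rewrite !mulmx1. Qed.

Lemma pair0 : E 0 0.
Proof.
have := PairLin (-1) (PairOne u v) (PairOne u v).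
by rewrite scaleN1r addNr.
Qed.

Lemma pairZ c P P' : E P P' -> E (c *: P) (c *: P').
Proof. by move=> EP; have := PairLin c EP pair0; rewrite !addr0. Qed.

Lemma pairD P P' Q Q' : E P P' -> E Q Q' -> E (P + Q) (P' + Q').
Proof. by move=> EP /(PairLin 1 EP); rewrite !scale1r. Qed.

Lemma pairN P P' : E P P' -> E (- P) (- P').
Proof. by move=> /(pairZ (-1)); rewrite !scaleN1r. Qed.

Lemma pairB P P' Q Q' : E P P' -> E Q Q' -> E (P - Q) (P' - Q').
Proof. by move=> EP /pairN; apply: pairD. Qed.

Lemma pair_scalar c : E c%:M c%:M.
Proof. by rewrite -scalemx1; apply/pairZ/PairOne. Qed.

Lemma pairM P P' Q Q' : E P P' -> E Q Q' -> E (P *m Q) (P' *m Q').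
Proof.
move=> EP EQ; elim: EP => [|k {}P {}P' _ IH|c {}P {}P' S S' _ IH1 _ IH2].
- by rewrite !mul1mx.
- by rewrite -!mulmxA; apply: PairGen.
- by rewrite !mulmxDl -!scalemxAl; apply: PairLin.
Qed.

End PairAlgebra.

Lemma pair_conj (F : fieldType) (n d : nat) (u v : mxtuple F n d) g h P P' :
  g \in unitmx -> h \in unitmx -> pair_alg u v P P' ->
  pair_alg (conj_act g u) (conj_act h v)
    (g *m P *m invmx g) (h *m P' *m invmx h).
Proof.
move=> gu hu; elim=> [|k {}P {}P' _ IH|c {}P {}P' S S' _ IH1 _ IH2].
- by rewrite !mulmx1 !mulmxV //; apply: PairOne.
- have := PairGen k IH; rewrite /conj_act.
  by rewrite -!mulmxA !(mulKmx gu, mulKmx hu).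
- rewrite !mulmxDr !mulmxDl -!(scalemxAl, scalemxAr).
  exact: PairLin.
Qed.

Lemma pair_horner (F : fieldType) (n d : nat) (u v : mxtuple F n.+1 d)
    (p : {poly F}) P P' :
  pair_alg u v P P' -> pair_alg u v (horner_mx P p) (horner_mx P' p).
Proof.
move=> EP; elim/poly_ind: p => [|p c IH]; first by rewrite !rmorph0; apply: pair0.
rewrite !rmorphD !rmorphM /= !horner_mx_X !horner_mx_C.
by apply: pairD; [apply: pairM | apply: pair_scalar].
Qed.

Definition eq_generators (R : comNzRingType) (u v : 'I_2 -> 'M[R]_3) :=
  [/\ forall k, eq_invariants (u k) (v k),
      \tr (u ord0 *m u ord_max) = \tr (v ord0 *m v ord_max),
      \tr (u ord0 *m u ord0 *m u ord_max) = \tr (v ord0 *m v ord0 *m v ord_max) &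
    [/\ \tr (u ord0 *m u ord_max *m u ord_max) =
        \tr (v ord0 *m v ord_max *m v ord_max),
      \tr (u ord0 *m u ord0 *m u ord_max *m u ord_max) =
        \tr (v ord0 *m v ord0 *m v ord_max *m v ord_max) &
      \tr (u ord0 *m u ord0 *m u ord_max *m u ord_max *m u ord0 *m u ord_max) =
        \tr (v ord0 *m v ord0 *m v ord_max *m v ord_max *m v ord0 *m v ord_max)]].

Lemma pair_alg_invariants (R : comNzRingType) (u v : 'I_2 -> 'M[R]_3) P P' :
  eq_generators u v -> pair_alg u v P P' -> eq_invariants P P'.
Proof.
case=> hk h1 h2 [h3 h4 h5].
have hw w : eq_tr (u ord0) (u ord_max) (v ord0) (v ord_max) w.
  by apply: eq_tr_word => //; rewrite /eq_tr /= !mulmx1 ?mulmxA.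
have pair_tr Q Q' : pair_alg u v Q Q' -> \tr Q = \tr Q'.
  (* The word [w] on the left absorbs the generator produced by [PairGen]. *)
  move=> EQ; suff: forall w, \tr (weval (u ord0) (u ord_max) w *m Q) =
      \tr (weval (v ord0) (v ord_max) w *m Q').
    by move/(_ [::]); rewrite /= !mul1mx.
  elim: EQ => [w|k {}Q {}Q' _ IH w|c {}Q {}Q' S S' _ IH1 _ IH2 w].
  - by rewrite !mulmx1; apply: hw.
  - have := IH (rcons w (k == ord0)).
    rewrite -cats1 !weval_cat /= !mulmx1 -!mulmxA.
    have [->//|k0] := eqVneq k ord0.
    rewrite (_ : k = ord_max) //; apply: val_inj; move: k0; rewrite -val_eqE.
    by case: k {IH} => [[|[|]]].
  - by rewrite !mulmxDr !mxtraceD -!scalemxAr !mxtraceZ IH1 IH2.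
elim=> [|k {}P {}P' EP IH|c {}P {}P' Q Q' EP IH1 EQ IH2].
- by split.
- have [ht hs hd] := IH; have [kt ks kd] := hk k.
  split; [by apply/pair_tr/PairGen | | by rewrite !det_mulmx hd kd].
  rewrite !s2_mul ht hs kt ks; apply: pair_tr; have Ek := pair_gen u v k.
  apply: pairM; apply: pairD; do ?exact: pair_scalar;
    by apply: pairB; [apply: pairM | apply: pairZ].
- have [ht hs hd] := IH1; have [kt ks kd] := IH2.
  have EcP := pairZ c EP.
  split; first by apply/pair_tr/pairD.
    by rewrite !s2D !s2Z hs ks !mxtraceZ ht kt; congr (_ - _); apply/pair_tr/pairM.
  rewrite !det3D !detZ hd kd !s2Z hs ks !mxtraceZ ht kt.
  congr (_ + _ + _ + _); apply/pair_tr/pairM => //;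
    apply: pairD; do ?exact: pair_scalar;
    by apply: pairB; [apply: pairM | do ?apply: pairZ].
Qed.

(** Inserting [delta_mx j j] cuts the sum over the middle index down to one term; with such an
    insertion at every vertex, the trace along a closed path is the product of its entries. *)
Lemma mulmx_delta_mul (R : comNzRingType) (n : nat) (X Y : 'M[R]_n) i j l :
  (X *m delta_mx j j *m Y) i l = X i j * Y j l.
Proof.
rewrite -(mul_delta_mx (0 : 'I_1)) mulmxA -colE -mulmxA -rowE mxE.
by rewrite big_ord1 !mxE.
Qed.

Lemma tr_delta_mul (R : comNzRingType) (n : nat) (X : 'M[R]_n) i :
  \tr (delta_mx i i *m X) = X i i.
Proof.
rewrite -(mul_delta_mx (0 : 'I_1)) -mulmxA mxtrace_mulC -rowE -colE.
by rewrite /mxtrace big_ord1 !mxE.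
Qed.

Lemma horner_lagrange (F : fieldType) (n : nat) (D : 'I_n -> F) i j :
  injective D ->
  (\prod_(l | l != i) ('X - (D l)%:P)).[D j] != 0 = (i == j).
Proof.
move=> D_inj; rewrite horner_prod prodf_seq_neq0.
have [->|ij] := eqVneq i j.
  apply/allP => l _; apply/implyP => lj; rewrite hornerXsubC subr_eq0.
  by rewrite (inj_eq D_inj) eq_sym.
apply/negP => /allP/(_ j (mem_index_enum _)); rewrite eq_sym ij /=.
by rewrite hornerXsubC subrr eqxx.
Qed.

(** The Lagrange polynomial vanishing at every [D l] except [D i] sends the diagonal matrix to a
    nonzero multiple of [delta_mx i i], in both components at once. *)
Lemma pair_delta (F : fieldType) (n d : nat) (u v : mxtuple F n.+1 d)
    (D : 'I_n.+1 -> F) i :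
  injective D -> pair_alg u v (diag_mx (\row_j D j)) (diag_mx (\row_j D j)) ->
  pair_alg u v (delta_mx i i) (delta_mx i i).
Proof.
move=> D_inj ED; pose p := \prod_(l | l != i) ('X - (D l)%:P).
have := pairZ (p.[D i])^-1 (pair_horner p ED).
suff -> : (p.[D i])^-1 *: horner_mx (diag_mx (\row_j D j)) p = delta_mx i i by [].
rewrite horner_mx_diag; apply/matrixP => x y; rewrite !mxE.
have := horner_lagrange i x D_inj; rewrite -/p; have [<-|] := eqVneq i x.
  have [->|iy] := eqVneq i y; first by move=> pi; rewrite mulr1n mulVf ?eqxx.
  by rewrite mulr0n mulr0.
move=> ix /negbFE/eqP ->; rewrite mul0rn mulr0.
by rewrite andbC; case: eqP.
Qed.

Lemma mxeval_eq_of_diag (F : fieldType) (d : nat) (f : matpoly F 3 d)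
    (u v : mxtuple F 3 d) (D : 'I_3 -> F) :
    unbounded F -> @GL_invariants F 3 d f -> injective D ->
    (forall P P', pair_alg u v P P' -> \tr P = \tr P') ->
    pair_alg u v (diag_mx (\row_j D j)) (diag_mx (\row_j D j)) ->
  mxeval f u = mxeval f v.
Proof.
move=> infF finv D_inj htr ED.
rewrite !(mxeval_balanced _ infF finv); apply: eq_bigr => m bal; congr (_ * _).
have Ei i := pair_delta i D_inj ED.
have Ek k := pair_gen u v k.
apply: balanced_monomial bal => [k i|k l i j|k l p i j h].
- by rewrite -!tr_delta_mul; apply/htr/pairM.
- rewrite -!mulmx_delta_mul -!tr_delta_mul; apply: htr.
  by do ![apply: pairM | apply: Ei | apply: Ek].
- rewrite -(mulmx_delta_mul (u k)) -(mulmx_delta_mul (v k)) -!mulmx_delta_mul.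
  rewrite -!tr_delta_mul; apply: htr.
  by do ![apply: pairM | apply: Ei | apply: Ek].
Qed.

(** The rows of [g] are eigenvectors; a Lagrange polynomial in [P] isolates any single term of a
    linear relation between them, so they are independent. *)
Lemma diagonalize_distinct (F : fieldType) (n : nat) (P : 'M[F]_n.+1)
    (D : 'I_n.+1 -> F) :
  injective D -> (forall i, root (char_poly P) (D i)) ->
  exists2 g : 'M[F]_n.+1, g \in unitmx & g *m P *m invmx g = diag_mx (\row_j D j).
Proof.
move=> D_inj rootD.
have /(@fin_all_exists _ _ (fun i w => w *m P = D i *: w /\ w != 0)) [w wP] :
    forall i, exists w : 'rV[F]_n.+1, w *m P = D i *: w /\ w != 0.
  move=> i; have /eigenvalueP[w wP w0] : eigenvalue P (D i).
    by rewrite eigenvalue_root_char.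
  by exists w.
pose g := \matrix_(i, j) w i 0 j.
have row_g i : row i g = w i by apply/rowP => j; rewrite !mxE.
have gP : g *m P = diag_mx (\row_j D j) *m g.
  apply/row_matrixP => i; rewrite row_mul row_g (wP i).1 mul_diag_mx.
  by apply/rowP => j; rewrite !mxE.
have comm p : horner_mx (diag_mx (\row_j D j)) p *m g = g *m horner_mx P p.
  elim/poly_ind: p => [|p c IH]; first by rewrite !rmorph0 mul0mx mulmx0.
  rewrite !rmorphD !rmorphM /= !horner_mx_X !horner_mx_C mulmxDl mulmxDr.
  by rewrite scalar_mxC -[in LHS]mulmxA -gP mulmxA IH mulmxA.
have gu : g \in unitmx.
  rewrite unitmxE unitfE; apply/negP => /det0P[x /rV0Pn[i xi] xg].
  pose p := \prod_(l | l != i) ('X - (D l)%:P).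
  have : x *m horner_mx (diag_mx (\row_j D j)) p *m g = 0.
    by rewrite -mulmxA comm mulmxA xg mul0mx.
  have -> : x *m horner_mx (diag_mx (\row_j D j)) p =
      (x 0 i * p.[D i]) *: delta_mx 0 i.
    rewrite horner_mx_diag mul_mx_diag; apply/rowP => j; rewrite !mxE eqxx /=.
    have := horner_lagrange i j D_inj; rewrite -/p (eq_sym i).
    by have [->|_ /negbFE/eqP->] := eqVneq j i; rewrite ?mulr1 ?mulr0.
  rewrite -scalemxAl -rowE row_g => /eqP; rewrite scaler_eq0 (negPf (wP i).2).
  rewrite orbF mulf_eq0 (negPf xi) /=.
  by apply/negP; rewrite horner_lagrange.
by exists g => //; rewrite gP mulmxK.
Qed.

(** * Algebras without separable elements *)

(** The discriminant of the cubic [x^3 - t x^2 + s x - p]; its integer coefficients make it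
    meaningful in every characteristic. *)
Definition disc3 (R : comNzRingType) (P : 'M[R]_3) : R :=
  let t := \tr P in let s := s2 P in let p := \det P in
  t ^+ 2 * s ^+ 2 - 4%:R * s ^+ 3 - 4%:R * t ^+ 3 * p
  + 18%:R * (t * s * p) - 27%:R * p ^+ 2.

Definition split3 (R : comNzRingType) (P : 'M[R]_3) (a b c : R) :=
  [/\ \tr P = a + b + c, s2 P = a * b + a * c + b * c & \det P = a * b * c].

Lemma disc3_split (R : comNzRingType) (P : 'M[R]_3) a b c :
  split3 P a b c -> disc3 P = ((a - b) * (a - c) * (b - c)) ^+ 2.
Proof. by case=> t s p; rewrite /disc3 t s p; ring. Qed.

Lemma s2_mulC (R : comNzRingType) (X Y : 'M[R]_3) : s2 (X *m Y) = s2 (Y *m X).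
Proof. by rewrite !s2_mul mxtrace_mulC. Qed.

Lemma conj_invariants (F : fieldType) (g P : 'M[F]_3) :
  g \in unitmx -> eq_invariants (g *m P *m invmx g) P.
Proof.
move=> gu; split.
- by rewrite mxtrace_mulC mulmxA mulVmx ?mul1mx.
- by rewrite s2_mulC mulmxA mulVmx ?mul1mx.
- by rewrite !det_mulmx mulrAC -det_mulmx mulmxV // det1 mul1r.
Qed.

Lemma eq_disc3 (R : comNzRingType) (P Q : 'M[R]_3) :
  eq_invariants P Q -> disc3 P = disc3 Q.
Proof. by rewrite /disc3 => -[-> -> ->]. Qed.

Lemma disc3_tr (R : comNzRingType) (P : 'M[R]_3) : disc3 P^T = disc3 P.
Proof.
apply: eq_disc3; split; rewrite ?mxtrace_tr ?det_tr //.
by rewrite /s2 !mxE; ring.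
Qed.

(** For singular [P] the adjugate [N] has rank at most one, whence [N X N = \tr (N X) N]; the
    remaining term is the correction, a multiple of [\det P]. *)
Lemma adj_sandwich (R : comNzRingType) (P X : 'M[R]_3) :
  \adj P *m X *m \adj P = \tr (\adj P *m X) *: \adj P
    - \det P *: (P *m X + X *m P - \tr P *: X - \tr X *: P
                 + (\tr P * \tr X - \tr (P *m X))%:M).
Proof. by rewrite !adj3; mx3 P; mx3 X; rewrite !inv3E !mk3E !inv3E; ring3. Qed.

Lemma s2_scalar_sub (R : comNzRingType) (P : 'M[R]_3) :
  s2 ((\tr P)%:M - P) = \tr P ^+ 2 + s2 P.
Proof. by mx3 P; rewrite !inv3E !mk3E !inv3E; ring. Qed.

(** Apart from one eigenvalue 0, the spectrum of [a b + c d] is that of the 2 by 2 matrix with rows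
    [(b a, b c)] and [(d a, d c)]. *)
Lemma rank2_invariants (R : comNzRingType) (a c : 'cV[R]_3) (b d : 'rV[R]_3) :
  let X := a *m b + c *m d in
  [/\ \tr X = (b *m a) 0 0 + (d *m c) 0 0,
      s2 X = (b *m a) 0 0 * (d *m c) 0 0 - (b *m c) 0 0 * (d *m a) 0 0
    & \det X = 0].
Proof.
have -> : a *m b + c *m d = \matrix_(i, j) (a i 0 * b 0 j + c i 0 * d 0 j).
  by apply/matrixP => i j; rewrite !mxE !big_ord1.
set M := \matrix_(i, j) _.
have -> : M = mk3 (M 0 0) (M 0 1) (M 0 (lift 0 1)) (M 1 0) (M 1 1) (M 1 (lift 0 1))
    (M (lift 0 1) 0) (M (lift 0 1) 1) (M (lift 0 1) (lift 0 1)).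
  apply/matrixP => -[[|[|[|//]]] ?] [[|[|[|//]]] ?]; rewrite [RHS]mxE /=;
    by congr (M _ _); apply: val_inj.
cbv zeta; rewrite !inv3E !mxE !big_ord_recl !big_ord0.
rewrite (_ : lift ord0 ord0 = 1 :> 'I_3); last exact: val_inj.
rewrite (_ : lift ord0 (lift ord0 ord0) = lift 0 1 :> 'I_3); last exact: val_inj.
by split; ring.
Qed.

(** A predicate, so that the two projections of [pair_alg] qualify without a choice of basis. *)
Definition mx_subalg (R : comNzRingType) (n : nat) (L : 'M[R]_n -> Prop) :=
  [/\ L 1%:M, forall c P Q, L P -> L Q -> L (c *: P + Q)
    & forall P Q, L P -> L Q -> L (P *m Q)].

Section MatrixSubalgebra.
Variables (F : fieldType) (L : 'M[F]_3 -> Prop).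
Hypothesis Lalg : mx_subalg L.

Lemma alg1 : L 1%:M. Proof. by case: Lalg. Qed.
Lemma algM P Q : L P -> L Q -> L (P *m Q).
Proof. by case: Lalg => _ _; apply. Qed.
Lemma alg_lin c P Q : L P -> L Q -> L (c *: P + Q).
Proof. by case: Lalg => _ + _; apply. Qed.
Lemma algD P Q : L P -> L Q -> L (P + Q).
Proof. by move=> LP LQ; rewrite -[P]scale1r; apply: alg_lin. Qed.
Lemma alg0 : L 0.
Proof. by have := alg_lin (-1) alg1 alg1; rewrite scaleN1r addNr. Qed.
Lemma algZ c P : L P -> L (c *: P).
Proof. by move=> LP; rewrite -[_ *: _]addr0; apply: alg_lin alg0. Qed.
Lemma alg_scalar c : L c%:M.
Proof. by rewrite -scalemx1; apply: algZ alg1. Qed.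
Lemma algB P Q : L P -> L Q -> L (P - Q).
Proof. by move=> LP LQ; rewrite addrC -scaleN1r; apply: alg_lin. Qed.
Lemma alg_adj P : L P -> L (\adj P).
Proof.
by move=> LP; rewrite adj3; apply: algD (alg_scalar _); apply: algB (algZ _ LP);
   apply: algM.
Qed.

(* If [P] is singular with [s2 P] nonzero, then [\adj P / s2 P] is a rank one
   idempotent. *)
Lemma rank1_idempotent P :
  L P -> \det P = 0 -> (\tr P != 0) || (s2 P != 0) ->
  exists (w : 'cV[F]_3) (y : 'rV[F]_3), y *m w = 1%:M /\ L (w *m y).
Proof.
wlog s0 : P / s2 P != 0.
  move=> IH LP dP; have [s0 t0|s0 _] := eqVneq (s2 P) 0; last first.
    by apply: (IH P) => //; rewrite s0 orbT.
  rewrite orbF in t0.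
  (* Here the spectrum of [P] is [0, 0, t] with [t] nonzero, so that of [t - P] is [t, t, 0]: still
     singular, but with [s2] equal to [t^2]. *)
  have e2 : s2 ((\tr P)%:M - P) != 0.
    by rewrite s2_scalar_sub s0 addr0 expf_neq0.
  apply: (IH ((\tr P)%:M - P)); rewrite ?e2 ?orbT //.
    by apply: algB LP; apply: alg_scalar.
  by rewrite det_scalar_sub s0 dP; ring.
move=> LP dP _; pose N := \adj P.
have trN : \tr N = s2 P.
  by rewrite /N adj3; mx3 P; rewrite !inv3E !mk3E !inv3E; ring.
have [i Nii] : exists i, N i i != 0.
  apply: contrapT => nN; case/negP: s0; rewrite -trN /mxtrace big1 // => i _.
  by apply: contra_notP nN => /eqP Ni; exists i.
have NN X : N *m X *m N = \tr (N *m X) *: N.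
  by rewrite /N adj_sandwich dP scale0r subr0.
have NE k l : N k i * N i l = N i i * N k l.
  rewrite -mulmx_delta_mul NN mxE; congr (_ * _).
  by rewrite mxtrace_mulC tr_delta_mul.
have LN : L N := alg_adj LP.
clearbody N; have c0 : s2 P * N i i != 0 by rewrite mulf_neq0.
exists (col i N), ((s2 P * N i i)^-1 *: row i N); split.
  rewrite -scalemxAl; apply/matrixP => x y; rewrite !ord1 !mxE eqxx.
  suff -> : \sum_j row i N 0 j * col i N j 0 = s2 P * N i i by rewrite mulVf.
  rewrite -trN /mxtrace mulr_suml; apply: eq_bigr => j _.
  by rewrite !mxE mulrC NE mulrC.
rewrite -scalemxAr; suff -> : col i N *m row i N = N i i *: N.
  by do 2!apply: algZ.
by apply/matrixP => k l; rewrite !mxE big_ord1 !mxE NE.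
Qed.

(** * Subalgebras whose singular elements are nilpotent *)

Section Local.
Hypothesis local : forall P, L P -> \det P = 0 -> \tr P = 0 /\ s2 P = 0.

Lemma local_unit P : L P -> \det P = 0 -> \det (1%:M - P) = 1.
Proof.
move=> LP dP; have [t0 s0] := local LP dP.
by rewrite det_scalar_sub t0 s0 dP; ring.
Qed.

(** If [U] inverted [P + Q], then [U P] would be singular, hence nilpotent, and [1 - U P = U Q]
    would be both invertible and singular. The inverse stays in [L] because the adjugate is a
    polynomial in the matrix. *)
Lemma local_add P Q :
  L P -> \det P = 0 -> L Q -> \det Q = 0 -> \det (P + Q) = 0.
Proof.
move=> LP dP LQ dQ; apply/eqP/negPn/negP => dn0.
have PQu : P + Q \in unitmx by rewrite unitmxE unitfE.
have LU : L (invmx (P + Q)).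
  by rewrite /invmx PQu; apply/algZ/alg_adj/algD.
have := local_unit (algM LU LP); rewrite det_mulmx dP mulr0 => /(_ erefl).
have -> : 1%:M - invmx (P + Q) *m P = invmx (P + Q) *m Q.
  by rewrite -(mulVmx PQu) mulmxDr addrAC subrr add0r.
by rewrite det_mulmx dQ mulr0 => /eqP; rewrite eq_sym oner_eq0.
Qed.

(** A nonzero [c] would make [- c] an eigenvalue of the nilpotent [Q]. *)
Lemma local_no_eigenvalue (w : 'cV[F]_3) c Q :
  w != 0 -> L Q -> \det Q = 0 -> c *: w + Q *m w = 0 -> c = 0.
Proof.
move=> w0 LQ dQ cw; apply/eqP; apply: contraNT w0 => c0.
pose Q' := - c^-1 *: Q.
have LQ' : L Q' by apply: algZ.
have dQ' : \det Q' = 0 by rewrite detZ dQ mulr0.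
have Qu : 1%:M - Q' \in unitmx by rewrite unitmxE (local_unit LQ' dQ') unitr1.
have : (1%:M - Q') *m w = 0.
  rewrite mulmxBl mul1mx /Q' scaleNr mulNmx opprK -scalemxAl.
  by apply: (scalerI c0); rewrite scalerDr scalerA mulfV // scale1r scaler0.
by move/(congr1 (mulmx (invmx (1%:M - Q')))); rewrite mulKmx // mulmx0 => ->.
Qed.

(* Otherwise some [w0, X1 w0, X2 X1 w0, X3 X2 X1 w0] would be linearly
   independent. *)
Lemma local_common_kernel A B :
  L A -> \det A = 0 -> L B -> \det B = 0 ->
  exists w : 'cV[F]_3, [/\ w != 0, A *m w = 0 & B *m w = 0].
Proof.
move=> LA dA LB dB; apply: contrapT => nw.
have step (w : 'cV[F]_3) :
    w != 0 -> exists X, [/\ L X, \det X = 0 & X *m w != 0].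
  move=> w0; have [Aw|Aw] := eqVneq (A *m w) 0; last by exists A.
  have [Bw|Bw] := eqVneq (B *m w) 0; last by exists B.
  by case: nw; exists w.
have e0 : (delta_mx 0 0 : 'cV[F]_3) != 0.
  by apply/eqP => /matrixP/(_ 0 0)/eqP; rewrite !mxE oner_eq0.
have [X1 [L1 d1 w1]] := step _ e0; have [X2 [L2 d2 w2]] := step _ w1.
have [X3 [L3 d3 w3]] := step _ w2.
set w := delta_mx 0 0 in e0 w1 w2 w3.
pose M := col_mx (col_mx w^T (X1 *m w)^T) (col_mx (X2 *m (X1 *m w))^T
            (X3 *m (X2 *m (X1 *m w)))^T).
have [x x0 xM] : exists2 x : 'rV[F]_(1 + 1 + (1 + 1)), x != 0 & x *m M = 0.
  have : kermx M != 0.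
    by rewrite -mxrank_eq0 mxrank_ker subn_eq0 -ltnNge (leq_ltn_trans (rank_leq_col _)).
  case/rowV0Pn => x xk x0; exists x => //; exact/sub_kermxP.
pose x1 := lsubmx (lsubmx x) 0 0; pose x2 := rsubmx (lsubmx x) 0 0.
pose x3 := lsubmx (rsubmx x) 0 0; pose x4 := rsubmx (rsubmx x) 0 0.
have comb : x1 *: w + x2 *: (X1 *m w) + (x3 *: (X2 *m (X1 *m w)) +
    x4 *: (X3 *m (X2 *m (X1 *m w)))) = 0.
  apply: trmx_inj; rewrite trmx0 -[RHS]xM -[x]hsubmxK /M.
  rewrite -[lsubmx x]hsubmxK -[rsubmx x]hsubmxK !mul_row_col.
  rewrite [lsubmx (lsubmx x)]mx11_scalar [rsubmx (lsubmx x)]mx11_scalar.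
  rewrite [lsubmx (rsubmx x)]mx11_scalar [rsubmx (rsubmx x)]mx11_scalar.
  by rewrite !mul_scalar_mx !linearD /= !linearZ.
pose N Q := L Q /\ \det Q = 0.
have ND P Q : N P -> N Q -> N (P + Q).
  by move=> [LP dP] [LQ dQ]; split; [apply: algD | apply: local_add].
have NZ c Q : N Q -> N (c *: Q).
  by move=> [LQ dQ]; split; [apply: algZ | rewrite detZ dQ mulr0].
have NM P Q : N P -> N Q -> N (P *m Q).
  by move=> [LP dP] [LQ dQ]; split; [apply: algM | rewrite det_mulmx dQ mulr0].
have [N1 N2 N3] : [/\ N X1, N X2 & N X3] by [].
(* In the relation [comb], the terms after the first one have the form [Q w] with [Q] in [L]
   singular, so the first coefficient vanishes; the same argument is repeated from the next vector
   on. *)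
have z1 : x1 = 0.
  have [LQ dQ] : N (x2 *: X1 + (x3 *: (X2 *m X1) + x4 *: (X3 *m (X2 *m X1)))).
    exact: ND _ _ (NZ _ _ N1) (ND _ _ (NZ _ _ (NM _ _ N2 N1))
      (NZ _ _ (NM _ _ N3 (NM _ _ N2 N1)))).
  apply: (local_no_eigenvalue e0 LQ dQ).
  by rewrite -[RHS]comb !mulmxDl -!scalemxAl -!mulmxA !addrA.
have z2 : x2 = 0.
  have [LQ dQ] : N (x3 *: X2 + x4 *: (X3 *m X2)).
    exact: ND _ _ (NZ _ _ N2) (NZ _ _ (NM _ _ N3 N2)).
  apply: (local_no_eigenvalue w1 LQ dQ).
  by rewrite -[RHS]comb z1 scale0r add0r !mulmxDl -!scalemxAl -!mulmxA.
have z3 : x3 = 0.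
  have [LQ dQ] : N (x4 *: X3) by apply: NZ.
  apply: (local_no_eigenvalue w2 LQ dQ).
  by rewrite -[RHS]comb z1 z2 !scale0r !add0r -!scalemxAl.
have z4 : x4 = 0.
  move: comb; rewrite z1 z2 z3 !scale0r !add0r => /eqP.
  by rewrite scaler_eq0 (negPf w3) orbF => /eqP.
case/negP: x0; rewrite -[x]hsubmxK -[lsubmx x]hsubmxK -[rsubmx x]hsubmxK.
rewrite [lsubmx (lsubmx x)]mx11_scalar [rsubmx (lsubmx x)]mx11_scalar.
rewrite [lsubmx (rsubmx x)]mx11_scalar [rsubmx (rsubmx x)]mx11_scalar.
rewrite -/x1 -/x2 -/x3 -/x4 z1 z2 z3 z4.
by rewrite !(raddf0, row_mx0).
Qed.

End Local.

End MatrixSubalgebra.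

(** * Common eigenvectors in algebras without separable elements *)

Lemma exists_nonroot (F : fieldType) (p : {poly F}) :
  unbounded F -> p != 0 -> exists x, p.[x] != 0.
Proof.
move=> infF; apply: contra_neqP => nx.
apply: (@poly_eq0_unbounded F F idfun) => // x /=.
by apply: contra_notP nx => /eqP px; exists x.
Qed.

(** The vector [w] tells [y] from [r], so the two forms are independent and their common kernel is a
    line. *)
Lemma collinear_of_orthogonal (F : fieldType) (y r : 'rV[F]_3)
    (w c x : 'cV[F]_3) :
    y *m w = 1%:M -> r *m w = 0 -> r != 0 -> c != 0 ->
    y *m c = 0 -> r *m c = 0 -> y *m x = 0 -> r *m x = 0 ->
  exists a, x = a *: c.
Proof.
move=> yw rw r0 c0 yc rc yx rx; pose G := col_mx y r.
have freeG : row_free G.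
  apply: inj_row_free => v; rewrite -[v]hsubmxK mul_row_col => vG.
  have v1 : lsubmx (v : 'rV_(1 + 1)) = 0.
    have := congr1 (mulmx^~ w) vG.
    by rewrite /= mulmxDl -!mulmxA yw rw mulmx0 addr0 mulmx1 mul0mx.
  move: vG; rewrite v1 mul0mx add0r [rsubmx _]mx11_scalar mul_scalar_mx => /eqP.
  by rewrite scaler_eq0 (negPf r0) orbF => /eqP->; rewrite raddf0 row_mx0.
have rank_ker : \rank (kermx G^T) = 1%N.
  by rewrite mxrank_ker mxrank_tr (eqP freeG).
have in_ker (z : 'cV[F]_3) : y *m z = 0 -> r *m z = 0 -> (z^T <= kermx G^T)%MS.
  move=> yz rz; apply/sub_kermxP; rewrite -trmx_mul mul_col_mx yz rz.
  by rewrite col_mx0 trmx0.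
have /eqmxP/eqmx_sym eq_c : (c^T == kermx G^T)%MS.
  rewrite -(geq_leqif (mxrank_leqif_eq (in_ker c yc rc))) rank_ker rank_rV.
  by rewrite trmx_eq0 c0.
have /sub_rVP[a xa] : (x^T <= c^T)%MS by rewrite -eq_c in_ker.
by exists a; apply: trmx_inj; rewrite xa linearZ.
Qed.

Definition common_eigvec (F : fieldType) (A B : 'M[F]_3) :=
  exists (z : 'cV[F]_3) (a b : F), [/\ z != 0, A *m z = a *: z & B *m z = b *: z].

(** Peirce decomposition along [e = w y]: [q X], [c X] and [r X] are the corner, column and row
    parts of [X]. If [c] vanishes on [A] and [B], then [w] is a common eigenvector; if [r] does,
    then [y] is one for the transposes. Otherwise a nonzero [c Z] spans the common kernel of [y] and
    some nonzero [r X], a line stable under [L] because all products [r X *m c Z] vanish. *)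
Lemma idempotent_common_eigvec (F : fieldType) (L : 'M[F]_3 -> Prop)
    (w : 'cV[F]_3) (y : 'rV[F]_3) A B :
    unbounded F -> mx_subalg L -> (forall P, L P -> disc3 P = 0) ->
    y *m w = 1%:M -> L (w *m y) -> L A -> L B ->
  common_eigvec A B \/ common_eigvec A^T B^T.
Proof.
move=> infF Lalg disc0 yw Le LA LB.
pose q X := (y *m X *m w) 0 0.
have qE X : y *m X *m w = (q X)%:M by rewrite -mx11_scalar.
pose c X := X *m w - q X *: w.
pose r X := y *m X - q X *: y.
have yc X : y *m c X = 0.
  by rewrite mulmxBr mulmxA qE -scalemxAr yw scalemx1 subrr.
have rw X : r X *m w = 0.
  by rewrite mulmxBl qE -scalemxAl yw scalemx1 subrr.
have Lc X : L X -> L ((1%:M - w *m y) *m X *m (w *m y)).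
  move=> LX; apply: (algM Lalg) => //; apply: (algM Lalg) => //.
  by apply: (algB Lalg) => //; apply: alg1.
have cE X : (1%:M - w *m y) *m X *m (w *m y) = c X *m y.
  rewrite mulmxA; congr (_ *m _).
  rewrite mulmxBl mul1mx mulmxBl -!mulmxA (mulmxA y) qE.
  by rewrite mul_mx_scalar.
have Lr X : L X -> L (w *m r X).
  move=> LX; have -> : w *m r X = w *m y *m X *m (1%:M - w *m y).
    rewrite /r mulmxBr mulmxBr mulmx1 -!mulmxA; congr (_ - _).
    by rewrite !mulmxA -(mulmxA w y X) -(mulmxA w) qE mul_mx_scalar -scalemxAl scalemxAr.
  apply: (algM Lalg); first exact: algM.
  by apply: (algB Lalg) => //; apply: alg1.
have rc0 X Z : L X -> L Z -> r X *m c Z = 0.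
  move=> LX LZ; set rho := (r X *m c Z) 0 0.
  rewrite [LHS]mx11_scalar -/rho.
  have [->|rho0] := eqVneq rho 0; first by rewrite raddf0.
  (* The element [l e + c Z *m r X] has eigenvalues [l], [rho] and [0]; this choice of [l] makes
     them distinct, against [disc0]. *)
  have [l] := infF [:: 0; rho]; rewrite !inE negb_or => /andP[l0 lrho].
  have LP : L ((l *: w) *m y + c Z *m r X).
    apply: (algD Lalg); first by rewrite -scalemxAl; apply: algZ.
    have -> : c Z *m r X = (c Z *m y) *m (w *m r X).
      by rewrite -mulmxA (mulmxA y) yw mul1mx.
    by apply: (algM Lalg); [rewrite -cE; apply: Lc | apply: Lr].
  have := disc0 _ LP; rewrite /disc3.
  have [-> -> ->] := rank2_invariants (l *: w) (c Z) y (r X).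
  rewrite yc -!scalemxAr yw rw -/rho scaler0 !mxE /= mulr1 => /eqP.
  have -> : (l + rho) ^+ 2 * (l * rho - 0 * 0) ^+ 2
      - 4%:R * (l * rho - 0 * 0) ^+ 3 - 4%:R * (l + rho) ^+ 3 * 0
      + 18%:R * ((l + rho) * (l * rho - 0 * 0) * 0) - 27%:R * 0 ^+ 2 =
      (l * rho * (l - rho)) ^+ 2 by ring.
  by rewrite expf_eq0 /= !mulf_eq0 subr_eq0 (negPf l0) (negPf rho0) (negPf lrho).
have w0 : w != 0.
  apply/eqP => w0; move: yw; rewrite w0 mulmx0 => /matrixP/(_ 0 0)/eqP.
  by rewrite !mxE eq_sym oner_eq0.
have y0 : y != 0.
  apply/eqP => y0; move: yw; rewrite y0 mul0mx => /matrixP/(_ 0 0)/eqP.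
  by rewrite !mxE eq_sym oner_eq0.
have [rAB|] := boolP ((r A == 0) && (r B == 0)).
  right; exists y^T, (q A), (q B); rewrite trmx_eq0 -!trmx_mul -!linearZ /=.
  have [/eqP rA /eqP rB] := andP rAB.
  by split=> //; congr trmx; apply/eqP; rewrite -subr_eq0; apply/eqP.
rewrite negb_and => rAB.
have [cAB|] := boolP ((c A == 0) && (c B == 0)).
  left; exists w, (q A), (q B); have [/eqP cA /eqP cB] := andP cAB.
  by split=> //; apply/eqP; rewrite -subr_eq0; apply/eqP.
rewrite negb_and => cAB.
have [X LX rX] : exists2 X, L X & r X != 0.
  by case/orP: rAB => ?; [exists A | exists B].
have [Z LZ cZ] : exists2 Z, L Z & c Z != 0.
  by case/orP: cAB => ?; [exists A | exists B].
have eig T : L T -> exists a, T *m c Z = a *: c Z.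
  move=> LT; have yTc : y *m (T *m c Z) = 0.
    have := rc0 T Z LT LZ; rewrite mulmxBl -scalemxAl yc scaler0 subr0.
    by rewrite mulmxA.
  apply: (collinear_of_orthogonal yw (rw X) rX cZ (yc Z)) => //.
    exact: rc0.
  (* [Z'] is [T (1 - e) Z], an element of [L] whose column part is [T *m c Z], so that [rc0] applies
     to it. *)
  pose Z' := T *m ((1%:M - w *m y) *m Z).
  have LZ' : L Z'.
    apply: (algM Lalg) => //; apply: (algM Lalg) => //.
    by apply: (algB Lalg) => //; apply: alg1.
  have Z'w : Z' *m w = T *m c Z.
    have := congr1 (mulmx^~ w) (cE Z).
    rewrite /= -(mulmxA _ (w *m y)) -(mulmxA w) yw mulmx1 -(mulmxA (c Z)) yw.
    by rewrite mulmx1 => <-; rewrite mulmxA.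
  suff <- : c Z' = T *m c Z by apply: rc0.
  by rewrite /c /q -mulmxA Z'w yTc mxE scale0r subr0.
have [a Aa] := eig A LA; have [b Bb] := eig B LB.
by left; exists (c Z), a, b.
Qed.

Lemma nonseparable_common_eigvec (F : fieldType) (L : 'M[F]_3 -> Prop) A B
    a b :
    unbounded F -> mx_subalg L -> (forall P, L P -> disc3 P = 0) ->
    L A -> L B -> \det (A - a%:M) = 0 -> \det (B - b%:M) = 0 ->
  common_eigvec A B \/ common_eigvec A^T B^T.
Proof.
move=> infF Lalg disc0 LA LB dA dB.
have [[P [LP dP tsP]]|nP] := pselect
    (exists P, [/\ L P, \det P = 0 & (\tr P != 0) || (s2 P != 0)]).
  have [w [y [yw Lwy]]] := rank1_idempotent Lalg LP dP tsP.
  exact: (idempotent_common_eigvec infF Lalg disc0 yw).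
have local P : L P -> \det P = 0 -> \tr P = 0 /\ s2 P = 0.
  move=> LP dP; split; apply/eqP; apply: contra_notT nP => h; exists P;
    by rewrite h ?orbT.
left; have [||w [w0 Aw Bw]] := local_common_kernel Lalg local _ dA _ dB.
- by apply: (algB Lalg) => //; apply: alg_scalar.
- by apply: (algB Lalg) => //; apply: alg_scalar.
exists w, a, b; split=> //.
  by move: Aw; rewrite mulmxBl mul_scalar_mx => /eqP; rewrite subr_eq0 => /eqP.
by move: Bw; rewrite mulmxBl mul_scalar_mx => /eqP; rewrite subr_eq0 => /eqP.
Qed.

(** * Simultaneous triangularization *)

Lemma parallel2 (F : fieldType) (c1 c2 d1 d2 : F) :
  (c1 != 0) || (c2 != 0) -> c1 * d2 = c2 * d1 ->
  exists a, d1 = a * c1 /\ d2 = a * c2.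
Proof.
have [->|c10 _ e] := eqVneq c1 0; last first.
  by exists (d1 / c1); rewrite divfK // mulrAC -[d1 * c2]mulrC -e mulrAC mulfV // mul1r.
rewrite /= mul0r => c20 /esym/eqP; rewrite mulf_eq0 (negPf c20) => /eqP ->.
by exists (d2 / c2); rewrite divfK // mulr0.
Qed.

Lemma rank1_factor2 (F : fieldType) (a b c d : F) :
  a * d = b * c -> [|| a != 0, b != 0, c != 0 | d != 0] ->
  exists x1 x2 y1 y2, [/\ (x1 != 0) || (x2 != 0), (y1 != 0) || (y2 != 0) &
    [/\ a = x1 * y1, b = x1 * y2, c = x2 * y1 & d = x2 * y2]].
Proof.
move=> e /or4P[] n0.
- exists a, c, 1, (b / a); rewrite n0 oner_eq0; split=> //.
  split; rewrite ?mulr1 //; first by rewrite mulrCA mulfV ?mulr1.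
  by rewrite mulrA [c * b]mulrC -e mulrAC mulfV ?mul1r.
- exists b, d, (a / b), 1; rewrite n0 oner_eq0 orbT; split=> //.
  split; rewrite ?mulr1 //; first by rewrite mulrCA mulfV ?mulr1.
  by rewrite mulrA [d * a]mulrC e mulrAC mulfV ?mul1r.
- exists a, c, 1, (d / c); rewrite n0 oner_eq0 orbT; split=> //.
  split; rewrite ?mulr1 //; last by rewrite mulrCA mulfV ?mulr1.
  by rewrite mulrA e mulfK.
- exists b, d, (c / d), 1; rewrite n0 oner_eq0 !orbT; split=> //.
  split; rewrite ?mulr1 //; last by rewrite mulrCA mulfV ?mulr1.
  by rewrite mulrA -e mulfK.
Qed.

Definition eigvec2 (F : fieldType) (p q r s a x y : F) :=
  p * x + q * y = a * x /\ r * x + s * y = a * y.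

Lemma exists_eigvec2 (F : fieldType) (p q r s mu : F) :
  mu ^+ 2 - (p + s) * mu + (p * s - q * r) = 0 ->
  exists x y, (x != 0) || (y != 0) /\ eigvec2 p q r s mu x y.
Proof.
move=> e; have e' : (p - mu) * (s - mu) = q * r.
  by apply/eqP; rewrite -subr_eq0 -e; apply/eqP; ring.
have [|] := boolP [|| p - mu != 0, q != 0, r != 0 | s - mu != 0].
  case/(rank1_factor2 e') => x1 [x2 [y1 [y2 [_ y0 [pE qE rE sE]]]]].
  exists (- y2), y1; rewrite oppr_eq0 orbC; split=> //.
  rewrite /eigvec2 -[p](subrK mu) -[s](subrK mu) pE qE rE sE.
  by split; ring.
rewrite !negb_or !negbK => /and4P[/eqP pE /eqP qE /eqP rE /eqP sE].
exists 1, 0; rewrite oner_eq0; split=> //.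
by split; rewrite ?rE ?qE ?(subr0_eq pE); ring.
Qed.

(* With [A - mu = c *m l] of rank one, [det [A, B]] is
   [det (c, B c) * det (l; l B)]. *)
Lemma common_eigvec2 (F : fieldType) (p q r s p' q' r' s' mu mu' : F) :
    mu ^+ 2 - (p + s) * mu + (p * s - q * r) = 0 ->
    mu' ^+ 2 - (p' + s') * mu' + (p' * s' - q' * r') = 0 ->
    (q * r' - q' * r) ^+ 2 + (p * q' + q * s' - p' * q - q' * s)
      * (r * p' + s * r' - r' * p - s' * r) = 0 ->
  exists x y a b, [/\ (x != 0) || (y != 0), eigvec2 p q r s a x y
                    & eigvec2 p' q' r' s' b x y].
Proof.
move=> e e' comm; have eN : (p - mu) * (s - mu) = q * r.
  by apply/eqP; rewrite -subr_eq0 -e; apply/eqP; ring.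
have [|] := boolP [|| p - mu != 0, q != 0, r != 0 | s - mu != 0]; last first.
  rewrite !negb_or !negbK => /and4P[/eqP pE /eqP qE /eqP rE /eqP sE].
  have [x [y [xy0 ev]]] := exists_eigvec2 e'.
  exists x, y, mu, mu'; split=> //.
  by split; rewrite ?rE ?qE ?(subr0_eq pE) ?(subr0_eq sE); ring.
case/(rank1_factor2 eN) => c1 [c2 [l1 [l2 [c0 l0 [pE qE rE sE]]]]].
have pE' : p = c1 * l1 + mu by rewrite -pE subrK.
have sE' : s = c2 * l2 + mu by rewrite -sE subrK.
have /eqP : (c1 * (r' * c1 + s' * c2) - c2 * (p' * c1 + q' * c2)) *
    (l1 * (l1 * q' + l2 * s') - l2 * (l1 * p' + l2 * r')) = 0.
  apply/eqP; rewrite -oppr_eq0 -comm; apply/eqP.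
  by rewrite pE' sE' qE rE; ring.
(* Either [c], which spans the image of [A - mu], is an eigenvector of [B], or the form [l] is one
   for the action on rows; then its kernel, spanned by [(- l2, l1)], is stable under [B], and [A]
   acts on it by [mu]. *)
rewrite mulf_eq0 !subr_eq0 => /orP[]/eqP h.
  have [b [h1 h2]] := parallel2 c0 h.
  exists c1, c2, (l1 * c1 + l2 * c2 + mu), b; split=> //.
  by rewrite /eigvec2 pE' sE' qE rE; split; ring.
have l0' : (- l2 != 0) || (l1 != 0) by rewrite oppr_eq0 orbC.
have h' : - l2 * (r' * - l2 + s' * l1) = l1 * (p' * - l2 + q' * l1).
  have -> : - l2 * (r' * - l2 + s' * l1) =
      l2 * (l1 * p' + l2 * r') - l1 * l2 * (p' + s') by ring.
  by rewrite -h; ring.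
have [b [h1 h2]] := parallel2 l0' h'.
exists (- l2), l1, mu, b; split=> //.
by rewrite /eigvec2 pE' sE' qE rE; split; ring.
Qed.

Lemma map_to_e0 (F : fieldType) (z : 'cV[F]_3) :
  z != 0 -> exists2 g : 'M[F]_3, g \in unitmx & g *m z = delta_mx 0 0.
Proof.
move=> z0; have cu := col_ebase_unit z; have := row_ebase_unit z.
have rz : \rank z = 1%N by rewrite -mxrank_tr rank_rV trmx_eq0 z0.
rewrite unitmxE det_mx11 unitfE => r0.
exists ((row_ebase z 0 0)^-1 *: invmx (col_ebase z)).
  by rewrite unitmxZ ?unitmx_inv // unitfE invr_eq0.
have zE : row_ebase z 0 0 *: (col_ebase z *m pid_mx 1) = z.
  by rewrite -mul_mx_scalar -mx11_scalar -[RHS]mulmx_ebase rz.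
rewrite -[X in _ *m X]zE -scalemxAr -scalemxAl scalerA mulKmx // divff // scale1r.
by apply/matrixP => i j; rewrite !mxE ord1 /= andbT; case: i => [[|i] ?].
Qed.

Lemma first_col_mk3 (F : fieldType) (A : 'M[F]_3) a :
  A *m delta_mx 0 0 = a *: (delta_mx 0 0 : 'cV[F]_3) ->
  exists x y p q r s, A = mk3 a x y 0 p q 0 r s.
Proof.
rewrite -colE; mx3 A => /colP eA.
have := eA 0; have := eA 1; have := eA (lift 0 1); rewrite !mxE /= !(mulr0, mulr1).
by move=> -> -> ->; exists b, c, e, f, h, i.
Qed.

Definition upper_triangular (F : fieldType) (A : 'M[F]_3) :=
  forall i j : 'I_3, (j < i)%N -> A i j = 0.

Lemma upper_triangular_mk3 (F : fieldType) (a b c e f i : F) :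
  upper_triangular (mk3 a b c 0 e f 0 0 i).
Proof. by move=> [[|[|[|//]]] ?] [[|[|[|//]]] ?]; rewrite mxE. Qed.

(** The corner [a] is one of the three eigenvalues; another one, counted with multiplicity, is an
    eigenvalue of the lower block. *)
Lemma quadratic_cofactor_root (F : fieldType) (a p q r s x y x' y' a1 a2 a3 : F) :
  split3 (mk3 a x y 0 p q 0 r s) a1 a2 a3 ->
  exists mu, mu ^+ 2 - (p + s) * mu + (p * s - q * r) = 0.
Proof.
rewrite /split3 !inv3E => -[ht hs hd].
have : (a - a1) * (a - a2) * (a - a3) = 0.
  have -> : (a - a1) * (a - a2) * (a - a3) =
      a ^+ 3 - (a1 + a2 + a3) * a ^+ 2 + (a1 * a2 + a1 * a3 + a2 * a3) * a
      - a1 * a2 * a3 by ring.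
  by rewrite -ht -hs -hd; ring.
have ps : p + s = a1 + a2 + a3 - a by rewrite -ht; ring.
have det2 : p * s - q * r = a1 * a2 + a1 * a3 + a2 * a3 - a * (p + s).
  by rewrite -hs; ring.
rewrite det2 ps => /eqP; rewrite !mulf_eq0 !subr_eq0.
by move=> /orP[/orP[]|] /eqP ->; [exists a2 | exists a1 | exists a1]; ring.
Qed.

(** Once the common eigenvector is the first basis vector, only the lower 2 by 2 blocks matter; they
    have a common eigenvector as soon as the determinant [d] of their commutator vanishes. *)
Lemma triangularize_of_eigvec (F : fieldType) (L : 'M[F]_3 -> Prop) A B
    a1 a2 a3 b1 b2 b3 :
    unbounded F -> mx_subalg L -> (forall P, L P -> disc3 P = 0) ->
    L A -> L B -> split3 A a1 a2 a3 -> split3 B b1 b2 b3 ->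
    common_eigvec A B ->
  exists2 g, g \in unitmx & upper_triangular (g *m A *m invmx g) /\
    upper_triangular (g *m B *m invmx g).
Proof.
move=> infF Lalg disc0 LA LB spA spB [z [a [b [z0 Az Bz]]]].
have [g gu gz] := map_to_e0 z0.
have conj_e0 M m : M *m z = m *: z ->
    g *m M *m invmx g *m delta_mx 0 0 = m *: (delta_mx 0 0 : 'cV[F]_3).
  by move=> Mz; rewrite -gz -!mulmxA mulKmx // Mz -scalemxAr.
have [x [y [p [q [r [s AE]]]]]] := first_col_mk3 (conj_e0 _ _ Az).
have [x' [y' [p' [q' [r' [s' BE]]]]]] := first_col_mk3 (conj_e0 _ _ Bz).
have spA' : split3 (mk3 a x y 0 p q 0 r s) a1 a2 a3.
  by rewrite -AE; have [h1 h2 h3] := conj_invariants A gu; rewrite /split3 h1 h2 h3.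
have spB' : split3 (mk3 b x' y' 0 p' q' 0 r' s') b1 b2 b3.
  by rewrite -BE; have [h1 h2 h3] := conj_invariants B gu; rewrite /split3 h1 h2 h3.
have [mu muP] := quadratic_cofactor_root x y spA'.
have [mu' muP'] := quadratic_cofactor_root x y spB'.
set d := - ((q * r' - q' * r) ^+ 2 + (p * q' + q * s' - p' * q - q' * s)
      * (r * p' + s * r' - r' * p - s' * r)).
have d0 : d = 0.
  apply/eqP/negPn/negP => dn0.
  pose t2 := p * p' + q * r' + (r * q' + s * s').
  pose m2 := (p * s - q * r) * (p' * s' - q' * r').
  (* [X2] is the determinant of [A B + 'X] on the lower block. The polynomial [d - 4 X2] is nonzero:
     its coefficient of degree 2 is [-4], or else [4 = 0] and it is the constant [d]. *)
  pose X2 : {poly F} := 'X^2 + t2%:P * 'X + m2%:P.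
  have X2c : X2`_2 = 1 by rewrite !coefD coefXn coefMX !coefC /= !addr0.
  have [l] : exists l, (X2 * (d%:P - 4%:R%:P * X2)).[l] != 0.
    apply: exists_nonroot => //; rewrite mulf_neq0 //.
      by apply/eqP => /(congr1 (fun P : {poly F} => P`_2))/eqP; rewrite X2c coef0 oner_eq0.
    apply/eqP => e; have := congr1 (fun P : {poly F} => P`_2) e.
    rewrite coefB coefC coefCM X2c coef0 sub0r mulr1 => /eqP; rewrite oppr_eq0 => /eqP e4.
    by move: e; rewrite e4 mul0r subr0 => /eqP; rewrite polyC_eq0 (negPf dn0).
  rewrite !hornerE /=; set m := l ^+ 2 + t2 * l + m2 => mP.
  (* On the lower block the commutator alone has trace 0, hence a repeated eigenvalue in
     characteristic 2. The factor [A B + l] changes the trace to [- d] and the determinant to [d m];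
     the discriminant of [P] becomes [d^3 m^2 (d - 4 m)], nonzero by the choice of [l]. *)
  pose P := (A *m B - B *m A) *m (A *m B + l%:M).
  have LP : L P.
    apply: (algM Lalg); first by apply: (algB Lalg); apply: algM.
    by apply: (algD Lalg); [apply: algM | apply: alg_scalar].
  have PE : g *m P *m invmx g =
      let A' := mk3 a x y 0 p q 0 r s in let B' := mk3 b x' y' 0 p' q' 0 r' s' in
      (A' *m B' - B' *m A') *m (A' *m B' + l%:M).
    cbv zeta; rewrite -AE -BE /P.
    have cM X Y : g *m (X *m Y) *m invmx g = g *m X *m invmx g *m (g *m Y *m invmx g).
      by rewrite -!mulmxA (mulKmx gu).
    rewrite cM mulmxBr mulmxDr mulmxBl mulmxDl !cM; congr (_ *m (_ + _)).
    by rewrite -mulmxA -scalar_mxC mulKVmx.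
  have := disc0 _ LP; rewrite -(eq_disc3 (conj_invariants P gu)) PE /disc3.
  have -> : \tr (let A' := mk3 a x y 0 p q 0 r s in
      let B' := mk3 b x' y' 0 p' q' 0 r' s' in
      (A' *m B' - B' *m A') *m (A' *m B' + l%:M)) = - d.
    by cbv zeta; rewrite !mk3E !inv3E /d; ring.
  have -> : s2 (let A' := mk3 a x y 0 p q 0 r s in
      let B' := mk3 b x' y' 0 p' q' 0 r' s' in
      (A' *m B' - B' *m A') *m (A' *m B' + l%:M)) = d * m.
    by cbv zeta; rewrite !mk3E !inv3E /d /m /t2 /m2; ring.
  have -> : \det (let A' := mk3 a x y 0 p q 0 r s in
      let B' := mk3 b x' y' 0 p' q' 0 r' s' in
      (A' *m B' - B' *m A') *m (A' *m B' + l%:M)) = 0.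
    by cbv zeta; rewrite !mk3E !inv3E; ring.
  move=> /eqP; apply/negP.
  rewrite (_ : _ + _ - _ = d ^+ 3 * m * (m * (d - 4%:R * m))); last by ring.
  by rewrite mulf_neq0 // mulf_neq0 ?expf_neq0 //; move: mP; rewrite mulf_eq0 negb_or => /andP[].
have comm : (q * r' - q' * r) ^+ 2 + (p * q' + q * s' - p' * q - q' * s)
      * (r * p' + s * r' - r' * p - s' * r) = 0.
  by move: d0; rewrite /d => /eqP; rewrite oppr_eq0 => /eqP.
have [z1 [z2 [al [be [zn0 [e1 e2] [e3 e4]]]]]] := common_eigvec2 muP muP' comm.
have [h1 [h2 hz]] : exists h1 h2, h1 * z1 + h2 * z2 = 1.
  case/orP: zn0 => n0; first by exists z1^-1, 0; rewrite mulVf // mul0r addr0.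
  by exists 0, z2^-1; rewrite mulVf // mul0r add0r.
(* The lower block of [h] sends [(z1, z2)] to the first basis vector and has determinant
   [h1 z1 + h2 z2 = 1]; [h'] is the inverse. *)
pose h := mk3 1 0 0 0 h1 h2 0 (- z2) z1.
pose h' := mk3 1 0 0 0 z1 (- h2) 0 z2 h1.
have hh' : h *m h' = 1%:M.
  rewrite /h /h' !mk3E; apply: eq_mk3; split; first [ring | rewrite -[RHS]hz; ring].
have [hu hu'] := mulmx1_unit hh'.
have hinv : invmx h = h'.
  by rewrite -[invmx h]mulmx1 -hh' mulmxA mulVmx // mul1mx.
have hg : (h *m g) *m (invmx g *m h') = 1%:M.
  by rewrite -mulmxA mulKVmx.
have hgu : h *m g \in unitmx by rewrite unitmx_mul hu.
have hginv : invmx (h *m g) = invmx g *m h'.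
  by rewrite -[invmx _]mulmx1 -hg mulmxA mulVmx // mul1mx.
have conj2 M : (h *m g) *m M *m invmx (h *m g) = h *m (g *m M *m invmx g) *m h'.
  by rewrite hginv !mulmxA.
exists (h *m g) => //; rewrite !conj2 AE BE /h /h' !mk3E.
split.
  rewrite [mk3 _ _ _ _ _ _ _ _ _](_ : _ = mk3 a (x * z1 + y * z2)
      (y * h1 - x * h2) 0 al (h1 * (q * h1 - p * h2) + h2 * (s * h1 - r * h2)) 0 0
      (- z2 * (q * h1 - p * h2) + z1 * (s * h1 - r * h2))).
    exact: upper_triangular_mk3.
  apply: eq_mk3; split; try ring.
  - have -> : al = h1 * (al * z1) + h2 * (al * z2).
      by rewrite -[LHS]mulr1 -hz; ring.
    by rewrite -e1 -e2; ring.
  - rewrite (_ : _ + _ = - z2 * (p * z1 + q * z2) + z1 * (r * z1 + s * z2)); last by ring.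
    by rewrite e1 e2; ring.
rewrite [mk3 _ _ _ _ _ _ _ _ _](_ : _ = mk3 b (x' * z1 + y' * z2)
    (y' * h1 - x' * h2) 0 be (h1 * (q' * h1 - p' * h2) + h2 * (s' * h1 - r' * h2)) 0 0
    (- z2 * (q' * h1 - p' * h2) + z1 * (s' * h1 - r' * h2))).
  exact: upper_triangular_mk3.
apply: eq_mk3; split; try ring.
- have -> : be = h1 * (be * z1) + h2 * (be * z2).
    by rewrite -[LHS]mulr1 -hz; ring.
  by rewrite -e3 -e4; ring.
- rewrite (_ : _ + _ = - z2 * (p' * z1 + q' * z2) + z1 * (r' * z1 + s' * z2)); last by ring.
  by rewrite e3 e4; ring.
Qed.

Lemma split3_root (F : fieldType) (A : 'M[F]_3) a b c :
  split3 A a b c -> \det (A - a%:M) = 0.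
Proof.
case=> ht hs hd; rewrite -opprB -scaleN1r detZ det_scalar_sub ht hs hd; ring.
Qed.

Lemma split3_tr (R : comNzRingType) (A : 'M[R]_3) a b c :
  split3 A a b c -> split3 A^T a b c.
Proof.
by case=> ht hs hd; split; rewrite ?mxtrace_tr ?det_tr // -hs /s2 !mxE; ring.
Qed.

(* Triangular for the order of the indices given by the weights [a]. *)
Definition weight_triangular (R : nmodType) (n : nat) (a : 'I_n -> nat) (T : 'M[R]_n) :=
  forall i j, (a i < a j)%N -> T i j = 0.

(** A common eigenvector of the transposes leads to lower instead of upper triangular matrices.
    Weights cover both cases and are the form in which the torus degeneration takes them. *)
Lemma triangularize (F : fieldType) (L : 'M[F]_3 -> Prop) A B
    a1 a2 a3 b1 b2 b3 :
    unbounded F -> mx_subalg L -> (forall P, L P -> disc3 P = 0) ->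
    L A -> L B -> split3 A a1 a2 a3 -> split3 B b1 b2 b3 ->
  exists2 g, g \in unitmx & exists2 a : 'I_3 -> nat, injective a &
    weight_triangular a (g *m A *m invmx g) /\
    weight_triangular a (g *m B *m invmx g).
Proof.
move=> infF Lalg disc0 LA LB spA spB.
have [ev|ev] := nonseparable_common_eigvec infF Lalg disc0 LA LB
  (split3_root spA) (split3_root spB).
  have [g gu [tA tB]] := triangularize_of_eigvec infF Lalg disc0 LA LB spA spB ev.
  exists g => //; exists (fun i : 'I_3 => 3 - i)%N.
    by move=> i j /= ij; apply: val_inj => /=; have := ltn_ord i; have := ltn_ord j; lia.
  by split=> i j /= ij; [apply: tA | apply: tB]; lia.
pose L' P := L P^T.
have Lalg' : mx_subalg L'.
  rewrite /L'; split; first by rewrite trmx1; apply: alg1.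
    by move=> c P Q LP LQ; rewrite linearP; apply: alg_lin.
  by move=> P Q LP LQ; rewrite trmx_mul; apply: algM.
have disc0' P : L' P -> disc3 P = 0 by move=> LP; rewrite -disc3_tr disc0.
have LA' : L' A^T by rewrite /L' trmxK.
have LB' : L' B^T by rewrite /L' trmxK.
have [g gu [tA tB]] := triangularize_of_eigvec infF Lalg' disc0' LA' LB'
  (split3_tr spA) (split3_tr spB) ev.
have gE M : invmx g^T *m M *m invmx (invmx g^T) = (g *m M^T *m invmx g)^T.
  by rewrite !trmx_mul trmxK trmx_inv invmxK mulmxA.
exists (invmx g^T); first by rewrite unitmx_inv unitmx_tr.
exists (fun i : 'I_3 => i); first by move=> i j /= ij; apply: val_inj.
by split=> i j /= ij; rewrite gE mxE; [apply: tA | apply: tB].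
Qed.

(** * Diagonal parts with a repeated entry *)

Lemma weight_triangular_split3 (R : comNzRingType) (a : 'I_3 -> nat) (T : 'M[R]_3) :
  injective a -> weight_triangular a T ->
  split3 T (T 0 0) (T 1 1) (T (lift 0 1) (lift 0 1)).
Proof.
move=> a_inj; mx3 T => tT.
have z01 := tT 0 1; have z10 := tT 1 0.
have z02 := tT 0 (lift 0 1); have z20 := tT (lift 0 1) 0.
have z12 := tT 1 (lift 0 1); have z21 := tT (lift 0 1) 1.
rewrite !mxE /= in z01 z10 z02 z20 z12 z21.
rewrite /split3 !inv3E !mxE /=.
have [h01|h01|/a_inj//] := ltngtP (a 0) (a 1);
have [h02|h02|/a_inj//] := ltngtP (a 0) (a (lift 0 1));
have [h12|h12|/a_inj//] := ltngtP (a 1) (a (lift 0 1)); try lia;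
rewrite ?(z01 h01) ?(z10 h01) ?(z02 h02) ?(z20 h02) ?(z12 h12) ?(z21 h12);
by split; ring.
Qed.

Lemma mxeval_perm_diag (F : fieldType) (n d : nat) (f : matpoly F n d)
    (D : 'I_d -> 'I_n -> F) (s : 'S_n) :
  @GL_invariants F n d f ->
  mxeval f (fun k => diag_mx (\row_i D k (s i))) =
  mxeval f (fun k => diag_mx (\row_i D k i)).
Proof.
move=> finv; rewrite -(finv _ (fun k => diag_mx (\row_i D k i)) (unitmx_perm F s)).
congr (mxeval f _); apply/funext => k; rewrite /conj_act.
suff -> : perm_mx s *m diag_mx (\row_i D k i) =
    diag_mx (\row_i D k (s i)) *m perm_mx s by rewrite mulmxK ?unitmx_perm.
apply/matrixP => i j; rewrite mul_mx_diag mul_diag_mx !mxE.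
by case: eqP => [->|]; rewrite ?mulr1 ?mul1r ?mulr0 ?mul0r.
Qed.

Definition repeated_diag (F : fieldType) (a x b y : F) : mxtuple F 3 2 :=
  fun k => diag_mx (\row_i (if k == ord0 then if i == 0 then a else x
                            else if i == 0 then b else y)).

Lemma ord3P (l : 'I_3) : [\/ l = 0, l = 1 | l = lift 0 1].
Proof.
by case: l => [[|[|[|//]]] ?]; [apply: Or31 | apply: Or32 | apply: Or33];
   apply: val_inj.
Qed.

(** The index outside [{i, j}] is moved to the front by a permutation matrix. The spectra are stated
    for arbitrary [A] and [B], so that they apply to the original tuple and not only to its diagonal
    part. *)
Lemma diag_pair_repeated (F : fieldType) (f : matpoly F 3 2)
    (al be : 'I_3 -> F) (i j : 'I_3) :
    @GL_invariants F 3 2 f -> i != j -> al i = al j -> be i = be j ->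
  exists a x b y,
    [/\ mxeval f (fun k => diag_mx (\row_i (if k == ord0 then al i else be i))) =
      mxeval f (repeated_diag a x b y),
      forall A, split3 A (al 0) (al 1) (al (lift 0 1)) -> split3 A a x x &
      forall B, split3 B (be 0) (be 1) (be (lift 0 1)) -> split3 B b y y].
Proof.
move=> finv ij aij bij.
have /existsP[l /andP[li lj]] : [exists l : 'I_3, (l != i) && (l != j)].
  apply: contraT; rewrite negb_exists => /forallP nl.
  have : (#|'I_3| <= #|[:: i; j]|)%N.
    apply/subset_leq_card/fintype.subsetP => x _.
    by have := nl x; rewrite negb_and !negbK !inE.
  by rewrite card_ord => /leq_trans/(_ (card_size _)).
have others m : m != l -> al m = al j /\ be m = be j.
  have [->|mi] := eqVneq m i; first by [].
  have [->|mj] := eqVneq m j; first by [].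
  move=> ml; exfalso; move: ij li lj mi mj ml; rewrite -!val_eqE /=.
  by have := ltn_ord i; have := ltn_ord j; have := ltn_ord l; have := ltn_ord m; lia.
exists (al l), (al j), (be l), (be j); split.
- pose D (k : 'I_2) m := if k == ord0 then al m else be m.
  rewrite -(mxeval_perm_diag D (tperm 0 l) finv); congr (mxeval f _).
  apply/funext => k; congr diag_mx; apply/rowP => m; rewrite !mxE /D.
  have [->|m0] := eqVneq m 0; first by rewrite tpermL.
  have [|-> ->//] := others (tperm 0 l m).
  by rewrite -{2}(tpermL 0 l) (inj_eq (@perm_inj _ _)).
- move=> A; rewrite /split3; case: (ord3P l) => lE; rewrite lE in others *.
  + by rewrite (others 1 isT).1 (others (lift 0 1) isT).1.
  + rewrite (others 0 isT).1 (others (lift 0 1) isT).1 => -[-> -> ->].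
    by split; ring.
  + rewrite (others 0 isT).1 (others 1 isT).1 => -[-> -> ->].
    by split; ring.
- move=> B; rewrite /split3; case: (ord3P l) => lE; rewrite lE in others *.
  + by rewrite (others 1 isT).2 (others (lift 0 1) isT).2.
  + rewrite (others 0 isT).2 (others (lift 0 1) isT).2 => -[-> -> ->].
    by split; ring.
  + rewrite (others 0 isT).2 (others 1 isT).2 => -[-> -> ->].
    by split; ring.
Qed.

Lemma split3_conj (F : fieldType) (g P : 'M[F]_3) a b c :
  g \in unitmx -> split3 (g *m P *m invmx g) a b c <-> split3 P a b c.
Proof. by move=> gu; rewrite /split3; have [-> -> ->] := conj_invariants P gu. Qed.

Lemma nonseparable_repeated_diag (F : fieldType) (L : 'M[F]_3 -> Prop)
    (f : matpoly F 3 2) (u : mxtuple F 3 2) a1 a2 a3 b1 b2 b3 :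
    unbounded F -> @GL_invariants F 3 2 f ->
    mx_subalg L -> (forall P, L P -> disc3 P = 0) -> (forall k, L (u k)) ->
    split3 (u ord0) a1 a2 a3 -> split3 (u ord_max) b1 b2 b3 ->
  exists a x b y, [/\ mxeval f u = mxeval f (repeated_diag a x b y),
    split3 (u ord0) a x x & split3 (u ord_max) b y y].
Proof.
move=> infF finv Lalg disc0 Lu spA spB.
have [g gu [w w_inj [tA tB]]] :=
  triangularize infF Lalg disc0 (Lu ord0) (Lu ord_max) spA spB.
set TA := _ *m _ *m _ in tA; set TB := _ *m _ *m _ in tB.
have dA := weight_triangular_split3 w_inj tA.
have dB := weight_triangular_split3 w_inj tB.
have kE (k : 'I_2) : k = if k == ord0 then ord0 else ord_max.
  by case: k => [[|[|//]] ?]; apply: val_inj.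
have fu : mxeval f u =
    mxeval f (fun k => diag_mx (\row_i (if k == ord0 then TA i i else TB i i))).
  rewrite -(finv _ u gu) (mxeval_degenerate (a := w) infF finv); last first.
    by move=> k i j ij; rewrite (kE k); case: ifP => _; [apply: tA | apply: tB].
  congr (mxeval f _); apply/funext => k; apply/matrixP => i j; rewrite !mxE.
  rewrite (inj_eq w_inj); have [->|] := eqVneq i j; last by rewrite !mulr0n.
  by rewrite !mulr1n {1}(kE k); case: ifP.
pose al i := TA i i; pose be i := TB i i.
(* For each [s], two diagonal entries of [TA + s TB] coincide, but which two may depend on [s]. The
   product of their differences is zero as a polynomial in [s], hence one factor is zero: the same
   two indices serve [TA] and [TB]. *)
pose lin i j : {poly F} := (al i - al j)%:P + (be i - be j)%:P * 'X.
have prod0 : lin 0 1 * lin 0 (lift 0 1) * lin 1 (lift 0 1) = 0.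
  apply: (@poly_eq0_unbounded F F idfun) => // s /=.
  have LP : L (s *: u ord_max + u ord0) by apply: alg_lin.
  pose T := s *: TB + TA.
  have TE : g *m (s *: u ord_max + u ord0) *m invmx g = T.
    by rewrite mulmxDr mulmxDl -scalemxAr -scalemxAl.
  have tT : weight_triangular w T.
    by move=> i j ij; rewrite /T mxE (tA _ _ ij) mxE (tB _ _ ij) mulr0 addr0.
  have TD i : T i i = al i + s * be i.
    by rewrite /T mxE [(s *: TB) i i]mxE addrC.
  have := disc0 _ LP; rewrite -(eq_disc3 (conj_invariants _ gu)) TE.
  rewrite (disc3_split (weight_triangular_split3 w_inj tT)) => /eqP.
  rewrite expf_eq0 /= => /eqP <-; rewrite !hornerE !TD.
  by ring.
have [i [j [ij aij bij]]] : exists i j, [/\ i != j, al i = al j & be i = be j].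
  have lin0 i j : lin i j = 0 -> al i = al j /\ be i = be j.
    move=> e; have := congr1 (coefp 0) e; have := congr1 (coefp 1) e.
    rewrite /= !coefD !coefMX !coefC /= add0r addr0.
    by move=> /subr0_eq -> /subr0_eq ->.
  move/eqP: prod0; rewrite !mulf_eq0 => /orP[/orP[]|] /eqP/lin0[h1 h2].
  - by exists 0, 1.
  - by exists 0, (lift 0 1).
  - by exists 1, (lift 0 1).
have [a [x [b [y [fE hA hB]]]]] := diag_pair_repeated finv ij aij bij.
exists a, x, b, y; split; first by rewrite fu.
  by apply/(split3_conj _ _ _ _ gu)/hA.
by apply/(split3_conj _ _ _ _ gu)/hB.
Qed.

(** Both sides give the same cubic [(z - a) (z - x)^2]. If [x] and [x'] differed, its values at [x]
    and [x'] would force [x = a'] and [x' = a], and comparing traces would give [x = a = x']. *)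
Lemma split3_repeated_inj (F : fieldType) (A A' : 'M[F]_3) a x a' x' :
  eq_invariants A A' -> split3 A a x x -> split3 A' a' x' x' ->
  a = a' /\ x = x'.
Proof.
rewrite /split3 => -[-> -> ->] [-> -> ->] [ht hs hd].
have cubic z : (z - a) * (z - x) ^+ 2 = (z - a') * (z - x') ^+ 2.
  transitivity (z ^+ 3 - (a + x + x) * z ^+ 2 + (a * x + a * x + x * x) * z
                - a * x * x); first by ring.
  by rewrite ht hs hd; ring.
have tr_x : x = x' -> a = a'.
  by move=> xx; move: ht; rewrite xx => /addIr/addIr.
suff xx : x = x' by rewrite xx tr_x.
apply/eqP/negPn/negP => xx'.
have := cubic x; rewrite subrr expr0n mulr0 => /esym/eqP.
rewrite mulf_eq0 expf_eq0 /= !subr_eq0 (negPf xx') orbF => /eqP xa'.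
have := cubic x'; rewrite subrr expr0n mulr0 => /eqP.
rewrite mulf_eq0 expf_eq0 /= !subr_eq0 [x' == x]eq_sym (negPf xx') orbF => /eqP x'a.
have /addrI xa : x + a + x = x + a + a.
  by rewrite {1}[x + a]addrC ht -xa' x'a.
by case/negP: xx'; rewrite x'a xa.
Qed.

Lemma split3_ext (F : fieldType) (P : 'M[F]_3) :
  exists (L : fieldType) (h : {rmorphism F -> L}) (a b c : L),
    split3 (map_mx h P) a b c.
Proof.
have mon := char_poly_monic P.
have [L [h [rs hrs]]] := splitting_ext (monic_neq0 mon).
exists L, h; rewrite map_char_poly in hrs.
have sz : size rs = 3%N.
  apply: succn_inj; rewrite -(size_prod_XsubC rs id) -(eqp_size hrs).
  by rewrite size_char_poly.
case: rs sz hrs => [|a [|b [|c []]]] // _; rewrite eqp_monic ?char_poly_monic //;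
  last by rewrite monic_prod_XsubC.
rewrite !big_cons big_nil mulr1 char_poly3 => /eqP e; exists a, b, c.
have e' : 'X^3 - (\tr (map_mx h P))%:P * 'X^2 + (s2 (map_mx h P))%:P * 'X
    - (\det (map_mx h P))%:P = 'X^3 - (a + b + c)%:P * 'X^2
    + (a * b + a * c + b * c)%:P * 'X - (a * b * c)%:P.
  by rewrite e; ring.
have coefE (t s p : L) : let q := 'X^3 - t%:P * 'X^2 + s%:P * 'X - p%:P in
    [/\ q`_2 = - t, q`_1 = s & q`_0 = - p].
  by split; rewrite !(coefB, coefD, coefCM, coefXn, coefX, coefC) /=; ring.
have [h2 h1 h0] := coefE (\tr (map_mx h P)) (s2 (map_mx h P)) (\det (map_mx h P)).
have [k2 k1 k0] := coefE (a + b + c) (a * b + a * c + b * c) (a * b * c).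
by split; [apply: oppr_inj; rewrite -h2 -k2 e' | rewrite -h1 -k1 e'
          | apply: oppr_inj; rewrite -h0 -k0 e'].
Qed.

(** * Separation *)

Section InvariantsMap.
Variables (R S : comNzRingType) (h : {rmorphism R -> S}).

Lemma s2_map (P : 'M[R]_3) : s2 (map_mx h P) = h (s2 P).
Proof. by rewrite /s2 !mxE -!(rmorphM, rmorphD, rmorphB). Qed.

Lemma disc3_map (P : 'M[R]_3) : disc3 (map_mx h P) = h (disc3 P).
Proof. by rewrite /disc3 trace_map_mx det_map_mx s2_map; ring. Qed.

Lemma split3_map (P : 'M[R]_3) a b c :
  split3 P a b c -> split3 (map_mx h P) (h a) (h b) (h c).
Proof.
case=> ht hs hd; split; rewrite ?trace_map_mx ?s2_map ?det_map_mx ?ht ?hs ?hd;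
  by rewrite !(rmorphM, rmorphD).
Qed.

Lemma eq_invariants_map (P P' : 'M[R]_3) :
  eq_invariants P P' -> eq_invariants (map_mx h P) (map_mx h P').
Proof. by case=> ht hs hd; split; rewrite ?trace_map_mx ?s2_map ?det_map_mx ?ht ?hs ?hd. Qed.

End InvariantsMap.

Lemma eq_generators_map (R S : comNzRingType) (h : {rmorphism R -> S})
    (u v : 'I_2 -> 'M[R]_3) :
  eq_generators u v ->
  eq_generators (fun k => map_mx h (u k)) (fun k => map_mx h (v k)).
Proof.
case=> hk h1 h2 [h3 h4 h5]; split; last split.
- by move=> k; apply: eq_invariants_map.
- by rewrite -!map_mxM !trace_map_mx h1.
- by rewrite -!map_mxM !trace_map_mx h2.
- by rewrite -!map_mxM !trace_map_mx h3.
- by rewrite -!map_mxM !trace_map_mx h4.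
- by rewrite -!map_mxM !trace_map_mx h5.
Qed.

Lemma pair_alg_map (R S : comNzRingType) (h : {rmorphism R -> S}) (n d : nat)
    (u v : 'I_d -> 'M[R]_n) P P' :
  pair_alg u v P P' ->
  pair_alg (fun k => map_mx h (u k)) (fun k => map_mx h (v k))
    (map_mx h P) (map_mx h P').
Proof.
elim=> [|k Q Q' _ IH|c Q Q' T T' _ IH1 _ IH2].
- by rewrite map_mx1; apply: PairOne.
- by rewrite !map_mxM; apply: PairGen.
- by rewrite !map_mxD !map_mxZ; apply: PairLin.
Qed.

Lemma mxeval_eq_ext (F K : fieldType) (h : {rmorphism F -> K}) (n d : nat)
    (f : matpoly F n d) (u v : mxtuple F n d) :
  mxeval (map_mpoly h f) (fun k => map_mx h (u k)) =
    mxeval (map_mpoly h f) (fun k => map_mx h (v k)) ->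
  mxeval f u = mxeval f v.
Proof. by rewrite !mxeval_map_mx => /fmorph_inj. Qed.

Lemma eq_split3 (R : comNzRingType) (P P' : 'M[R]_3) a b c :
  eq_invariants P P' -> split3 P a b c -> split3 P' a b c.
Proof. by rewrite /split3 => -[-> -> ->]. Qed.

Lemma split3_char_root (R : comNzRingType) (P : 'M[R]_3) a b c :
  split3 P a b c ->
  char_poly P = ('X - a%:P) * ('X - b%:P) * ('X - c%:P).
Proof. by case=> ht hs hd; rewrite char_poly3 ht hs hd; ring. Qed.

(* Over an extension splitting [P], conjugate [P] and [P'] to the same diagonal
   matrix. *)
Lemma mxeval_eq_of_separable (F : fieldType) (f : matpoly F 3 2)
    (u v : mxtuple F 3 2) P P' :
    unbounded F -> @GL_invariants F 3 2 f -> eq_generators u v ->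
    pair_alg u v P P' -> disc3 P != 0 ->
  mxeval f u = mxeval f v.
Proof.
move=> infF finv guv EP dP.
have [K [h [a [b [c spP]]]]] := split3_ext P.
apply: (mxeval_eq_ext (h := h)).
have infK := unbounded_inj (fmorph_inj h) infF.
have kinv := GL_invariants_map h infF finv.
have kuv := eq_generators_map h guv; have EkP := pair_alg_map h EP.
set f' := map_mpoly h f in kinv *.
set u' := fun k => map_mx h (u k) in kuv EkP *.
set v' := fun k => map_mx h (v k) in kuv EkP *.
have spP' := eq_split3 (pair_alg_invariants kuv EkP) spP.
have dP' : disc3 (map_mx h P) != 0 by rewrite disc3_map fmorph_eq0.
rewrite (disc3_split spP) expf_eq0 /= !mulf_eq0 !negb_or !subr_eq0 in dP'.
have /andP[/andP[ab ac] bc] := dP'.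
pose D (i : 'I_3) := nth a [:: a; b; c] i.
have D_inj : injective D.
  have uD : uniq [:: a; b; c] by rewrite /= !inE negb_or ab ac bc.
  move=> i j /eqP; rewrite /D nth_uniq ?ltn_ord // => /eqP; exact: val_inj.
have rootD (Q : 'M[K]_3) : split3 Q a b c -> forall i, root (char_poly Q) (D i).
  move=> spQ i; rewrite (split3_char_root spQ) !rootM !root_XsubC /D.
  by case: (ord3P i) => ->; rewrite /= eqxx ?orbT.
have [g gu gP] := diagonalize_distinct D_inj (rootD _ spP).
have [k ku kP] := diagonalize_distinct D_inj (rootD _ spP').
(* The conjugators [g] and [k] are unrelated; this is harmless, since [f] and the traces are
   invariant in each component separately. *)
rewrite -(kinv g u' gu) -(kinv k v' ku).
have := pair_conj gu ku EkP; rewrite gP kP => ED.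
apply: (mxeval_eq_of_diag infK kinv D_inj _ ED) => Q Q' EQ.
have giu : invmx g \in unitmx by rewrite unitmx_inv.
have kiu : invmx k \in unitmx by rewrite unitmx_inv.
have := pair_conj giu kiu EQ; rewrite !invmxK.
have cE (m : 'M[K]_3) (w : mxtuple K 3 2) :
    m \in unitmx -> conj_act (invmx m) (conj_act m w) = w.
  by move=> mu; apply/funext => l; rewrite /conj_act invmxK -!mulmxA mulKmx // mulVmx ?mulmx1.
rewrite !cE // => /(pair_alg_invariants kuv)[+ _ _].
by rewrite mxtrace_mulC mulmxA mulmxV // mul1mx mxtrace_mulC mulmxA mulmxV // mul1mx.
Qed.

Lemma mxeval_eq_of_split (F : fieldType) (f : matpoly F 3 2)
    (u v : mxtuple F 3 2) a1 a2 a3 b1 b2 b3 :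
    unbounded F -> @GL_invariants F 3 2 f -> eq_generators u v ->
    split3 (u ord0) a1 a2 a3 -> split3 (u ord_max) b1 b2 b3 ->
  mxeval f u = mxeval f v.
Proof.
move=> infF finv guv spA spB.
have [[P [P' [EP dP]]]|nsep] :=
    pselect (exists P P', pair_alg u v P P' /\ disc3 P != 0).
  exact: mxeval_eq_of_separable EP dP.
have disc0 P P' : pair_alg u v P P' -> disc3 P = 0.
  by move=> EP; apply/eqP; apply: contra_notT nsep => dP; exists P, P'.
have [hk _ _ _] := guv.
pose Lu P := exists P', pair_alg u v P P'.
pose Lv P' := exists P, pair_alg u v P P'.
have Lu_alg : mx_subalg Lu.
  split; first by exists 1%:M; apply: PairOne.
    by move=> c P Q [P' EP] [Q' EQ]; exists (c *: P' + Q'); apply: PairLin.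
  by move=> P Q [P' EP] [Q' EQ]; exists (P' *m Q'); apply: pairM.
have Lv_alg : mx_subalg Lv.
  split; first by exists 1%:M; apply: PairOne.
    by move=> c P' Q' [P EP] [Q EQ]; exists (c *: P + Q); apply: PairLin.
  by move=> P' Q' [P EP] [Q EQ]; exists (P *m Q); apply: pairM.
have Lu0 P : Lu P -> disc3 P = 0 by move=> [P' /disc0].
have Lv0 P' : Lv P' -> disc3 P' = 0.
  move=> [P EP]; rewrite -(eq_disc3 (pair_alg_invariants guv EP)).
  exact: disc0 EP.
have Luk k : Lu (u k) by exists (v k); apply: pair_gen.
have Lvk k : Lv (v k) by exists (u k); apply: pair_gen.
have [a [x [b [y [-> sA sB]]]]] :=
  nonseparable_repeated_diag infF finv Lu_alg Lu0 Luk spA spB.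
have [a' [x' [b' [y' [-> sA' sB']]]]] :=
  nonseparable_repeated_diag infF finv Lv_alg Lv0 Lvk
    (eq_split3 (hk ord0) spA) (eq_split3 (hk ord_max) spB).
have [-> ->] := split3_repeated_inj (hk ord0) sA sA'.
by have [-> ->] := split3_repeated_inj (hk ord_max) sB sB'.
Qed.

Lemma mxeval_eq_of_generators (F : fieldType) (f : matpoly F 3 2)
    (u v : mxtuple F 3 2) :
  unbounded F -> @GL_invariants F 3 2 f -> eq_generators u v ->
  mxeval f u = mxeval f v.
Proof.
move=> infF finv guv.
have [K [h [a1 [a2 [a3 spA]]]]] := split3_ext (u ord0).
apply: (mxeval_eq_ext (h := h)).
have infK := unbounded_inj (fmorph_inj h) infF.
have kinv := GL_invariants_map h infF finv; have kuv := eq_generators_map h guv.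
have [K' [h' [b1 [b2 [b3 spB]]]]] := split3_ext (map_mx h (u ord_max)).
apply: (mxeval_eq_ext (h := h')).
exact: (mxeval_eq_of_split (unbounded_inj (fmorph_inj h') infK)
  (GL_invariants_map h' infK kinv) (eq_generators_map h' kuv) (split3_map h' spA) spB).
Qed.

(** * Minimality *)

Definition generators_of (R : comNzRingType) (A B : 'M[R]_3) : seq R :=
  [:: \tr A; sigma 2 A; \det A; \tr B; sigma 2 B; \det B;
      \tr (A *m B); \tr (A ^+ 2 *m B); \tr (A *m B ^+ 2);
      \tr (A ^+ 2 *m B ^+ 2); \tr (A ^+ 2 *m B ^+ 2 *m A *m B)].

Definition generator_values (R : comNzRingType) (A B : 'M[R]_3) : seq R :=
  [:: \tr A; s2 A; \det A; \tr B; s2 B; \det B;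
      \tr (A *m B); \tr (A *m A *m B); \tr (A *m B *m B);
      \tr (A *m A *m B *m B); \tr (A *m A *m B *m B *m A *m B)].

Lemma generators_ofE (R : comNzRingType) (A B : 'M[R]_3) :
  generators_of A B = generator_values A B.
Proof.
have sqr (M : 'M[R]_3) : M ^+ 2 = M *m M by [].
by rewrite /generators_of !sigma2_s2 !sqr !mulmxA.
Qed.

Lemma generator_values_map (R S : comNzRingType) (phi : {rmorphism R -> S})
    (A B : 'M[R]_3) :
  map phi (generator_values A B) =
  generator_values (map_mx phi A) (map_mx phi B).
Proof. by rewrite /= -!trace_map_mx -!det_map_mx -!s2_map !map_mxM. Qed.

Definition generators (F : fieldType) : seq (matpoly F 3 2) :=
  generators_of (generic_mx F 3 ord0) (generic_mx F 3 ord_max).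

Lemma map_generic_mx (F : fieldType) (n d : nat) (v : mxtuple F n d) k :
  map_mx (meval (entry v)) (generic_mx F n k) = v k.
Proof. by apply/matrixP => i j; rewrite !mxE mevalXU entryE. Qed.

Lemma mxeval_generators (F : fieldType) (v : mxtuple F 3 2) :
  [seq mxeval p v | p <- generators F] = generator_values (v ord0) (v ord_max).
Proof.
pose phi : {rmorphism matpoly F 3 2 -> F} := meval (entry v).
rewrite -[LHS]/(map phi (generators F)) /generators generators_ofE.
by rewrite generator_values_map !(map_generic_mx v).
Qed.

Lemma generator_values_eq (F : fieldType) (u v : mxtuple F 3 2) :
  generator_values (u ord0) (u ord_max) = generator_values (v ord0) (v ord_max) ->
  eq_generators u v.
Proof.
case=> *; split=> // k.
have -> : k = if k == ord0 then ord0 else ord_max.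
  by case: k => [[|[|//]] ?]; apply: val_inj.
by case: ifP.
Qed.

Lemma generators_invariant (F : fieldType) p :
  p \in generators F -> @GL_invariants F 3 2 p.
Proof.
move=> pL g v gu.
have inv (P Q : 'M[F]_3) : g *m P *m invmx g *m (g *m Q *m invmx g) = g *m (P *m Q) *m invmx g.
  by rewrite -!mulmxA (mulKmx gu).
have : generator_values (conj_act g v ord0) (conj_act g v ord_max) =
    generator_values (v ord0) (v ord_max).
  rewrite /generator_values /conj_act !inv.
  have E P := conj_invariants P gu.
  have trE P : \tr (g *m P *m invmx g) = \tr P by case: (E P).
  have s2E P : s2 (g *m P *m invmx g) = s2 P by case: (E P).
  have detE P : \det (g *m P *m invmx g) = \det P by case: (E P).
  by rewrite !trE !s2E !detE.
by rewrite -!mxeval_generators => /eq_in_map/(_ p pL).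
Qed.

Lemma generators_separating (F : fieldType) :
  unbounded F -> separating [set` generators F].
Proof.
move=> infF; split=> [p /generators_invariant //|u v [f finv fuv]].
apply: contrapT => nsep; apply/fuv/mxeval_eq_of_generators => //.
apply: generator_values_eq; rewrite -!mxeval_generators; apply/eq_in_map => p pL.
by apply: contrapT => puv; apply: nsep; exists p.
Qed.

Definition mxpair (R : Type) (n : nat) (A B : 'M[R]_n) (k : 'I_2) : 'M[R]_n :=
  if k == ord0 then A else B.

Ltac eval_generators :=
  rewrite /generator_values !mk3E !inv3E /=;
  do 11?[apply: (congr2 cons); first by ring]; by [].

Lemma generator_values_unit (R : comNzRingType) (i : nat) :
  (i < 9)%N -> exists A B : 'M[R]_3,
    generator_values A B = [seq (j == i)%:R | j <- iota 0 11].
Proof.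
pose Z : 'M[R]_3 := mk3 0 0 0 0 0 0 0 0 0.
have vE (A B : 'M[R]_3) s : generator_values A B = s ->
  exists A B : 'M[R]_3, generator_values A B = s by exists A, B.
(* For one matrix: a rank one idempotent, a signed transposition and a 3-cycle. For the mixed
   traces: the edges of a single cycle, distributed over [A] and [B] so that it spells the wanted
   word. *)
case: i => [|[|[|[|[|[|[|[|[|//]]]]]]]]] _;
  [ apply: (vE (mk3 1 0 0 0 0 0 0 0 0) Z)
  | apply: (vE (mk3 0 1 0 (-1) 0 0 0 0 0) Z)
  | apply: (vE (mk3 0 1 0 0 0 1 1 0 0) Z)
  | apply: (vE Z (mk3 1 0 0 0 0 0 0 0 0))
  | apply: (vE Z (mk3 0 1 0 (-1) 0 0 0 0 0))
  | apply: (vE Z (mk3 0 1 0 0 0 1 1 0 0))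
  | apply: (vE (mk3 0 1 0 0 0 0 0 0 0) (mk3 0 0 0 1 0 0 0 0 0))
  | apply: (vE (mk3 0 1 0 0 0 1 0 0 0) (mk3 0 0 0 0 0 0 1 0 0))
  | apply: (vE (mk3 0 0 0 0 0 0 1 0 0) (mk3 0 1 0 0 0 1 0 0 0)) ];
  rewrite /Z; eval_generators.
Qed.

Lemma generator_witness (F : fieldType) (i : nat) :
  (i < 11)%N -> exists A B A' B' : 'M[F]_3, forall j, (j < 11)%N ->
    (nth 0 (generator_values A B) j == nth 0 (generator_values A' B') j) = (j != i).
Proof.
move=> i11; have [i9|i9] := ltnP i 9.
  have [A [B AB]] := generator_values_unit F i9.
  exists A, B, 0, 0 => j j11.
  have -> : generator_values 0 0 = nseq 11 0 :> seq F.
    rewrite /generator_values !mulmx0 !raddf0 !det0 /s2 !mxE.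
    by rewrite !mulr0 !subr0 !addr0.
  rewrite AB nth_nseq j11 (nth_map 0%N) ?size_iota // nth_iota // add0n.
  by case: (j == i); rewrite ?oner_eq0 ?eqxx.
have [->|->] : i = 9%N \/ i = 10%N by lia.
(* [A^2] is the first diagonal unit and reads off the first diagonal entry [-1] of [B^2]; the lower
   entry of [A] adds the entry [-1] of [B^2] in row 2, column 3, which cancels [\tr (A B^2)]. In the
   second pair, the square of the first matrix meets a zero diagonal entry instead. *)
- exists (mk3 (-1) 0 0 0 0 0 0 1 0), (mk3 0 1 1 (-1) 0 0 0 0 0),
    (mk3 0 0 0 0 (-1) 0 0 0 0), (mk3 0 0 (-1) 0 0 0 1 0 0) => j j11.
  have -> : generator_values (mk3 (-1) 0 0 0 0 0 0 1 0) (mk3 0 1 1 (-1) 0 0 0 0 0)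
      = [:: -1; 0; 0; 0; 1; 0; 0; 0; 0; -1; 0] :> seq F.
    by eval_generators.
  have -> : generator_values (mk3 0 0 0 0 (-1) 0 0 0 0) (mk3 0 0 (-1) 0 0 0 1 0 0)
      = [:: -1; 0; 0; 0; 1; 0; 0; 0; 0; 0; 0] :> seq F.
    by eval_generators.
  by case: j j11 => [|[|[|[|[|[|[|[|[|[|[|]]]]]]]]]]] //= _; rewrite ?eqxx // oppr_eq0 oner_eq0.
(* Up to conjugation by [diag (1, 1, -1)], the second pair is the first with [A] and [B] exchanged.
   The first ten values do not notice the exchange, whereas [AABBAB] has trace 1 and [BBAABA] has
   trace 0. *)
- exists (mk3 0 0 (-1) (-1) 0 0 0 0 0), (mk3 0 0 0 (-1) 0 0 0 (-1) 0),
    (mk3 0 0 0 (-1) 0 0 0 1 0), (mk3 0 0 1 (-1) 0 0 0 0 0) => j j11.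
  have -> : generator_values (mk3 0 0 (-1) (-1) 0 0 0 0 0) (mk3 0 0 0 (-1) 0 0 0 (-1) 0)
      = [:: 0; 0; 0; 0; 0; 0; 0; -1; -1; 0; 1] :> seq F.
    by eval_generators.
  have -> : generator_values (mk3 0 0 0 (-1) 0 0 0 1 0) (mk3 0 0 1 (-1) 0 0 0 0 0)
      = [:: 0; 0; 0; 0; 0; 0; 0; -1; -1; 0; 0] :> seq F.
    by eval_generators.
  by case: j j11 => [|[|[|[|[|[|[|[|[|[|[|]]]]]]]]]]] //= _; rewrite ?eqxx // oner_eq0.
Qed.


Lemma generators_minimal (F : fieldType) (S : set (matpoly F 3 2)) :
  S `<` [set` generators F] -> ~ separating S.
Proof.
move=> [subS nsub] [_ sepS].
have [p pL pS] : exists2 p, p \in generators F & ~ S p.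
  apply: contrapT => np; apply: nsub => p pL.
  by apply: contrapT => pS; apply: np; exists p.
have i11 : (index p (generators F) < 11)%N by rewrite -index_mem in pL.
have [A [B [A' [B' wit]]]] := generator_witness F i11.
have evalE q : q \in generators F ->
    (mxeval q (mxpair A B) == mxeval q (mxpair A' B')) =
    (index q (generators F) != index p (generators F)).
  move=> qL; rewrite -[in LHS](nth_index 0 qL).
  have jL : (index q (generators F) < size (generators F))%N by rewrite index_mem.
  by rewrite -!(nth_map 0 0 (fun p => mxeval p _) jL) !mxeval_generators wit.
have [|q Sq /eqP quv] := sepS (mxpair A B) (mxpair A' B').
  exists p; first exact: generators_invariant.
  by apply/eqP; rewrite evalE // eqxx.
have qL := subS q Sq; move: quv; rewrite evalE // negbK => /eqP qp.
by apply: pS; rewrite -(nth_index 0 pL) -qp nth_index.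
Qed.

Theorem theorem3p1 (F : fieldType) (F_infinite : infinite_set [set: F]) :
  let X1 : 'M[matpoly F 3 2]_3 := generic_mx F 3 (ord0 : 'I_2) in
  let X2 : 'M[matpoly F 3 2]_3 := generic_mx F 3 (ord_max : 'I_2) in
  minimal_separating
    [set` [:: \tr X1; sigma 2 X1; \det X1;
              \tr X2; sigma 2 X2; \det X2;
              \tr (X1 *m X2);
              \tr (X1 ^+ 2 *m X2);
              \tr (X1 *m X2 ^+ 2);
              \tr (X1 ^+ 2 *m X2 ^+ 2);
              \tr (X1 ^+ 2 *m X2 ^+ 2 *m X1 *m X2)]].
Proof.
move=> X1 X2; split; last exact: generators_minimal.
exact: generators_separating (infinite_unbounded F_infinite).
Qed.
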